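(* For any distribution $D$ on $\mathcal X\times\{-1,1\}$, any set $\mathcal H$ of voters $\mathcal X\to[-1,1]$, any prior $P$ on $\mathcal H$ and any $\delta\in(0,1]$, with probability at least $1-\delta$ over $S\sim D^m$, for all posteriors $Q$ on $\mathcal H$, $$\mathrm{kl}\big(\alpha_Q^S,\beta_Q^S\,\big\|\,\alpha_Q^D,\beta_Q^D\big)\ \le\ \frac1m\Big[2\,\mathrm{KL}(Q\|P)+\ln\frac{\xi(m)+m}{\delta}\Big],$$ where $\alpha_Q^{D'}$ and $\beta_Q^{D'}$ are any two distinct choices among $d_Q^{D'}$, $e_Q^{D'}$, $s_Q^{D'}$.
   Context: $\mathcal L_\ell(a,y)=\tfrac12(1-ya)$. For $D'\in\{S,D\}$ ($S$ meaning the uniform distribution on the sample): $e_Q^{D'}=\mathbb E_{f_1,f_2\sim Q}\mathbb E_{D'}\mathcal L_\ell(f_1(x),y)\mathcal L_\ell(f_2(x),y)$, $s_Q^{D'}=\mathbb E_{f_1,f_2\sim Q}\mathbb E_{D'}[1-\mathcal L_\ell(f_1(x),y)][1-\mathcal L_\ell(f_2(x),y)]$, $d_Q^{D'}=\mathbb E_{f_1,f_2\sim Q}\mathbb E_{D'}\tfrac12(1-f_1(x)f_2(x))$; $f_1,f_2$ drawn independently. $\mathrm{kl}(q_1,q_2\|p_1,p_2)=q_1\ln\frac{q_1}{p_1}+q_2\ln\frac{q_2}{p_2}+(1-q_1-q_2)\ln\frac{1-q_1-q_2}{1-p_1-p_2}$. $\mathrm{KL}(Q\|P)=\mathbb E_Q\ln\frac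 QP$. $\xi(m)=\sum_{k=0}^m\binom mk(k/m)^k(1-k/m)^{m-k}$. $P$ is independent of $S$. *)

(* Defs.v *)
From HB Require Import structures.
From mathcomp Require Import all_boot all_order all_algebra.
From mathcomp Require Import all_classical all_reals all_analysis.
Set Implicit Arguments. Unset Strict Implicit. Unset Printing Implicit Defensive.
Import Order.TTheory GRing.Theory Num.Theory.
Local Open Scope classical_set_scope.
Local Open Scope ring_scope.

(* Labels {-1, 1} are encoded by bool: true |-> 1, false |-> -1. *)
Definition lab {R : realType} (b : bool) : R := if b then 1 else -1.

Definition lossl {R : realType} (a y : R) : R := (1 - y * a) / 2.

Inductive stat := stat_d | stat_e | stat_s.

Definition stat_fun {R : realType} (t : stat) (a1 a2 y : R) : R :=
  match t with
  | stat_d => (1 - a1 * a2) / 2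
  | stat_e => lossl a1 y * lossl a2 y
  | stat_s => (1 - lossl a1 y) * (1 - lossl a2 y)
  end.

(* The statistic on the true distribution D: E_{f1,f2 ~ Q} E_D [ ... ],
   with f1, f2 drawn independently from Q.  Voters are given by an
   evaluation map v : H -> X -> R. *)
Definition stat_D {R : realType} {dX dH : measure_display}
  {X : measurableType dX} {H : measurableType dH}
  (v : H -> X -> R) (D : probability (X * bool)%type R)
  (Q : probability H R) (t : stat) : R :=
  fine (\int[Q]_h1 \int[Q]_h2 \int[D]_z
          (stat_fun t (v h1 z.1) (v h2 z.1) (lab z.2))%:E)%E.

Definition stat_S {R : realType} {dX dH : measure_display}
  {X : measurableType dX} {H : measurableType dH}
  (v : H -> X -> R) {m : nat} (S : 'I_m -> (X * bool)%type)
  (Q : probability H R) (t : stat) : R :=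
  fine (\int[Q]_h1 \int[Q]_h2
          ((m%:R)^-1 * \sum_(i < m)
              stat_fun t (v h1 (S i).1) (v h2 (S i).1) (lab (S i).2))%:E)%E.

(* q ln (q/p), with the conventions 0 ln(0/p) = 0 and q ln(q/0) = +oo (q > 0) *)
Definition klterm {R : realType} (q p : R) : \bar R :=
  if q == 0 then 0%E else if p <= 0 then +oo%E else (q * ln (q / p))%:E.

Definition kl2 {R : realType} (q1 q2 p1 p2 : R) : \bar R :=
  (klterm q1 p1 + klterm q2 p2 + klterm (1 - q1 - q2) (1 - p1 - p2))%E.

Definition lnE {R : realType} (x : \bar R) : \bar R :=
  match x with
  | EFin r => if 0 < r then (ln r)%:E else -oo%E
  | +oo%E => +oo%E
  | -oo%E => -oo%E
  end.

Definition KL {R : realType} {dH : measure_display} {H : measurableType dH}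
  (Q P : probability H R) : \bar R :=
  if pselect (Q `<< P) then
    (\int[Q]_h lnE (Radon_Nikodym (charge_of_finite_measure Q) P h))%E
  else +oo%E.

(* xi(m) = sum_k C(m,k) (k/m)^k (1 - k/m)^(m-k), with 0^0 = 1 *)
Definition xi {R : realType} (m : nat) : R :=
  \sum_(k < m.+1) 'C(m, k)%:R * (k%:R / m%:R) ^+ k
                   * (1 - k%:R / m%:R) ^+ (m - k).

(* Z : 'I_m -> Omega -> X * bool is an i.i.d. sample of size m drawn from D
   on the probability space (Omega, Pr), i.e. S = (Z_i)_i ~ D^m. *)
Definition iid_sample {R : realType} {dO dZ : measure_display}
  {Omega : measurableType dO} {Z : measurableType dZ}
  (Pr : probability Omega R) (D : probability Z R) (m : nat)
  (S : 'I_m -> Omega -> Z) : Prop :=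
  (forall i, measurable_fun setT (S i)) /\
  (forall A : 'I_m -> set Z, (forall i, measurable (A i)) ->
     Pr (\bigcap_(i in [set: 'I_m]) (S i @^-1` A i)) = (\prod_(i < m) D (A i))%E).

(* Main.v *)
(** For a pair of voters the three losses d, e, s are nonnegative and sum to 1,
so every example is a point of the simplex: a random colour among three.

Write q for the empirical and p for the true mean of these points, and let
[r_j > 0] be weights. Weighted AM-GM bounds [exp(m sum_j q_j ln r_j)] by
[prod_i sum_j u_ij r_j], which expands into a sum over the colourings s of the
sample. Since [x <= e^(x-1)], the power [prod_j r_j^(k_j)], with [k_j] the number
of examples of colour j, is at most
[prod_j (k_j/(m p_j))^(k_j) exp(m (sum_j p_j r_j - 1))]. Hence
[exp(m (sum_j q_j ln r_j + 1 - sum_j p_j r_j))] is at most a random variable U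
independent of r, whose mean is, by independence, at most
[sum_s prod_j (k_j/m)^(k_j)]. This number is [xi m + m] (Younsi's identity),
because [B = sum_n n^n z^n/n!] satisfies [B^3 - B^2 = z B'].

Markov's inequality applied to the average of U over pairs of voters drawn from
the prior, and the Donsker-Varadhan inequality used once in each of the two
voters, bound [m (sum_j q_j ln r_j + 1 - sum_j p_j r_j)] for the posterior means
q, p by [2 KL(Q||P) + ln((xi m + m)/delta)], on one event for all r and Q. The
supremum over r of the left-hand side is [m kl(q||p)]. *)
Require Import Defs.
From HB Require Import structures.
From mathcomp Require Import all_boot all_order all_algebra.
From mathcomp Require Import all_classical all_reals all_analysis.
From mathcomp Require Import measurable_realfun.
From mathcomp Require Import ring lra.
Import Order.TTheory GRing.Theory Num.Theory.
Import numFieldNormedType.Exports.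
Local Open Scope ring_scope.

Set Implicit Arguments. Unset Strict Implicit. Unset Printing Implicit Defensive.

(** * Colourings and Younsi's identity *)

(** Substituting ['X + 1] changes neither the size nor the leading coefficient, so the top
    coefficients cancel. *)
Lemma size_finite_diff (R : idomainType) (p : {poly R}) :
  (size (p \Po ('X + 1) - p)%R <= (size p).-1)%N.
Proof.
have [->|p0] := eqVneq p 0; first by rewrite comp_poly0 subr0 size_poly0.
have sX : size ('X + 1 : {poly R}) = 2%N by rewrite -[1]opprK -polyCN size_XsubC.
have lX : lead_coef ('X + 1 : {poly R}) = 1 by rewrite -[1 in LHS]opprK -polyCN lead_coefXsubC.
have sc : size (p \Po ('X + 1)) = size p by rewrite size_comp_poly2.
have s0 : (0 < size p)%N by rewrite lt0n size_poly_eq0.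
apply/leq_sizeP => j; rewrite leq_eqVlt => /orP[/eqP <-|lj].
  rewrite coefB -lead_coefE; apply/eqP; rewrite subr_eq0; apply/eqP.
  have := lead_coef_comp p (_ : (1 < size ('X + 1 : {poly R})%R)%N).
  by rewrite sX lX expr1n mulr1 => <- //; rewrite lead_coefE sc.
have sj : (size p <= j)%N by move: lj; rewrite prednK.
by rewrite coefB !nth_default ?sc ?subr0.
Qed.

(** The difference of order [n.+1] of [p] is the difference of order [n] of [p(X + 1) - p], whose
    size is smaller. *)
Lemma finite_diff_horner (R : idomainType) (n : nat) (p : {poly R}) (x : R) :
  (size p <= n)%N ->
  \sum_(k < n.+1) (-1) ^+ (n - k) *+ 'C(n, k) * p.[x + k%:R] = 0.
Proof.
elim: n p => [|n IH] p sp.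
  move: sp; rewrite leqn0 size_poly_eq0 => /eqP ->.
  by rewrite big1 // => i _; rewrite horner0 mulr0.
have sq : (size (p \Po ('X + 1) - p)%R <= n)%N.
  by apply: leq_trans (size_finite_diff p) _; case: (size p) sp.
apply: etrans (IH _ sq).
under [RHS]eq_bigr => k _ do
  rewrite hornerD hornerN horner_comp hornerD hornerX hornerC mulrBr.
rewrite sumrB.
rewrite big_ord_recl [X in _ = _ - X]big_ord_recl /=.
rewrite big_ord_recr [X in _ = X - _]big_ord_recr /=.
rewrite !bin0 !subn0 !binn !subnn !mulr1n !expr0 !mul1r.
have -> : x + (bump 0 n)%:R = x + n%:R + 1 by rewrite /bump /= ?add1n -natr1; ring.
(* Pascal's rule splits each interior term into one term of either difference. *)
have E : forall i : 'I_n, (-1) ^+ (n.+1 - bump 0 i) *+ 'C(n.+1, bump 0 i) * p.[x + (bump 0 i)%:R] =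
   (-1) ^+ (n - i) *+ 'C(n, i) * p.[x + i%:R + 1]
   - (-1) ^+ (n - bump 0 i) *+ 'C(n, bump 0 i) * p.[x + (bump 0 i)%:R].
  move=> i; rewrite /bump /= add1n subSS binS mulrnDr.
  have -> : x + i.+1%:R = x + i%:R + 1 by rewrite -natr1; ring.
  have -> : (n - i = (n - i.+1).+1)%N by rewrite subnSK.
  by rewrite exprS mulN1r mulrDl !mulNrn !mulNr addrC.
rewrite (eq_bigr _ (fun i _ => E i)) sumrB exprS mulN1r mulNr.
by move: (\sum_(_ < n) _) (\sum_(_ < n) _) ((-1) ^+ n) p.[_] p.[_] => *; ring.
Qed.

(* Expand [(n - k)^(n - k)] binomially: what remains is a finite difference of
   a monomial of too small degree, except for its term at [k = 0]. *)
Lemma abel_diag (R : idomainType) (n : nat) : (0 < n)%N ->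
  \sum_(1 <= k < n.+1) ('C(n, k) * (k ^ k.-1 * (n - k) ^ (n - k)))%:R
   = (n ^ n)%:R :> R.
Proof.
move=> n0.
(* [F k l] is the term with [(- k) ^+ (l - k)] in the expansion of [(n - k) ^ (n - k)]. The factor
   [k ^ k.-1] completes the power to [k ^ l.-1], and the binomials are regrouped by [Hb]. *)
pose F (k l : nat) : R := ('C(n, l) * n ^ (n - l))%:R *
   ((-1) ^+ (l - k) *+ 'C(l, k) * k%:R ^+ l.-1).
transitivity (\sum_(1 <= k < n.+1) \sum_(k <= l < n.+1) F k l).
  rewrite !big_nat; apply: eq_bigr => k /andP[k0 kn].
  rewrite !natrM (natrX _ (n - k)) natrB // exprDn mulr_sumr mulr_sumr.
  have -> : \sum_(k <= l < n.+1) F k l = \sum_(i < (n - k).+1) F k (i + k)%N.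
    by rewrite -{1}[k]add0n big_addn subSn // big_mkord.
  apply: eq_bigr => i _.
  rewrite /F addnK.
  have -> : (n - (i + k) = n - k - i)%N by rewrite subnDA subnAC.
  have ki : (i + k).-1 = (k.-1 + i)%N by rewrite -subn1 -addnBA // addnC subn1.
  have Hb : ('C(n, i + k) * 'C(i + k, k))%N = ('C(n, k) * 'C(n - k, i))%N.
    have ink : (i + k <= n)%N by have := ltn_ord i; rewrite ltnS leq_subRL // addnC.
    apply/eqP; rewrite -(eqn_pmul2r (_ : 0 < k`! * i`! * (n - k - i)`!)%N) ?muln_gt0 ?fact_gt0 //.
    have h1 := bin_fact ink.
    have h2 : ('C(i + k, k) * (k`! * i`!) = (i + k)`!)%N.
      by rewrite -(bin_fact (leq_addl i k)) addnK.
    have h3 := bin_fact (kn : (k <= n)%N).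
    have ik : (i <= n - k)%N by have := ltn_ord i; rewrite ltnS.
    have h4 := bin_fact ik.
    apply/eqP; transitivity n`!.
      by rewrite -h1 -h2 (addnC i k) subnDA -!mulnA.
    by rewrite -h3 -h4 -!mulnA; congr muln; rewrite mulnCA.
  have HbR : 'C(n, k)%:R * 'C(n - k, i)%:R = 'C(n, i + k)%:R * 'C(i + k, k)%:R :> R.
    by rewrite -!natrM Hb.
  rewrite ki exprD natrM !natrX [(- k%:R) ^+ _]exprNn -[_ *+ 'C(n - k, i)]mulr_natr.
  rewrite -[_ *+ 'C(i + k, k)]mulr_natr.
  move: HbR (n%:R ^+ _) (k%:R ^+ k.-1) (k%:R ^+ i) ((-1) ^+ i).
  move: 'C(n, k)%:R 'C(n - k, i)%:R 'C(n, i + k)%:R 'C(i + k, k)%:R.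
  move=> c1 c2 c3 c4 E x y z t.
  transitivity ((c1 * c2) * (x * y * z * t)); first by ring.
  by rewrite E; ring.
transitivity (\sum_(1 <= l < n.+1) \sum_(1 <= k < l.+1) F k l).
  under eq_big_nat => k /andP[k0 kn] do rewrite (big_nat_widenl _ 1) //.
  under [RHS]eq_big_nat => l /andP[l0 ln] do rewrite (big_nat_widen _ _ n.+1) //.
  by rewrite (exchange_big_dep_nat xpredT) //=.
(* The [l]-th difference of ['X^(l.-1)] at 0 vanishes. The sum here lacks its term at [k = 0], which
   contains [0 ^+ l.-1] and survives only for [l = 1]. *)
have inner l : (0 < l)%N -> \sum_(1 <= k < l.+1) F k l =
    if l == 1%N then (n ^ n)%:R else 0.
  move=> l0; rewrite /F -mulr_sumr.
  have := @finite_diff_horner R l 'X^(l.-1) 0 _.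
  rewrite size_polyXn prednK // leqnn => /(_ isT).
  rewrite -(big_mkord xpredT (fun k => (-1) ^+ (l - k) *+ 'C(l, k) * ('X^(l.-1)).[0 + k%:R])) big_ltn //.
  under eq_bigr => k _ do rewrite hornerXn add0r.
  rewrite bin0 subn0 mulr1n add0r hornerXn.
  case: eqP => [->|/eqP l1] /=.
    rewrite expr0 expr1 mulr1 => /eqP; rewrite addrC subr_eq0 => /eqP ->.
    by rewrite mulr1 bin1 -expnS subn1 prednK.
  have -> : (0%:R : R) ^+ l.-1 = 0.
    by rewrite expr0n; case: (l) l0 l1 => [|[]].
  by rewrite mulr0 add0r => ->; rewrite mulr0.
rewrite (eq_big_nat _ _ (fun l h => inner l (proj1 (andP h)))).
rewrite big_ltn //= big1_seq ?addr0 // => l /andP[_].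
by rewrite mem_index_iota => /andP[l2 _]; case: eqP l2 => // ->.
Qed.

(* With [T = z e^T] the tree function, [B = 1 / (1 - T)]. Differentiating
   [B = 1 + T B] and using [z T' = B - 1] gives [B^3 - B^2 = z B'], here modulo
   ['X^(N.+1)]. *)
Lemma tree_function_relation (R : numFieldType) (N : nat)
    (B := \poly_(n < N.+1) ((n ^ n)%:R / n`!%:R) : {poly R}) :
  (B ^+ 3 - B ^+ 2)`_N = ('X * deriv B)`_N.
Proof.
pose T : {poly R} := \poly_(n < N.+1) (if n == 0%N then 0 else (n ^ n.-1)%:R / n`!%:R).
have cB i : B`_i = if (i < N.+1)%N then (i ^ i)%:R / i`!%:R else 0.
  by rewrite coef_poly.
have cT i : T`_i = if (i < N.+1)%N then
    if i == 0%N then 0 else (i ^ i.-1)%:R / i`!%:R else 0 by rewrite coef_poly.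
(* Exact in spite of the truncation, since both sides stop at degree [N]. *)
have XT : 'X * deriv T = B - 1.
  apply/polyP => i; rewrite coefXM coefB coef1 cB coef_deriv cT.
  case: i => [|i] /=; first by rewrite expn0 fact0 divr1 subrr.
  rewrite subr0; case: ifP => [_|_]; last by rewrite mul0rn.
  rewrite -mulr_natr expnS natrM; field. 
  by rewrite pnatr_eq0 -lt0n fact_gt0.
(* Coefficientwise this is [abel_diag] divided by a factorial; [r] collects the degrees above
   [N]. *)
have [r Br] : exists r, B = 1 + T * B + r * 'X^(N.+1).
  suff h i : (i < N.+1)%N -> (B - (1 + T * B))`_i = 0.
    exists (drop_poly N.+1 (B - (1 + T * B))).
    rewrite -[LHS](subrK (1 + T * B)) addrC; congr (_ + _).
    rewrite -[LHS](poly_take_drop N.+1).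
    rewrite [X in X + _](_ : _ = 0) ?add0r //.
    by apply/polyP => i; rewrite coef_take_poly coef0; case: ifP => // /h.
  move=> iN; rewrite coefB coefD coef1 coefM cB iN.
  have [->|i0] := eqVneq i 0%N.
    by rewrite big_ord1 cT /= mul0r addr0 expn0 fact0 divr1 subrr.
  rewrite add0r; apply/eqP; rewrite subr_eq0; apply/eqP.
  rewrite -abel_diag ?lt0n // mulr_suml.
  rewrite -(big_mkord xpredT (fun k => T`_k * B`_(i - k))) [RHS]big_ltn //.
  rewrite cT /= mul0r add0r !big_nat; apply: eq_bigr => k /andP[k0 ki].
  rewrite cB cT (leq_ltn_trans _ iN) // (leq_ltn_trans _ iN) ?leq_subr //.
  rewrite eqn0Ngt k0 /= -(bin_fact (ltnSE ki)) !natrM; field.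
  by rewrite !pnatr_eq0 -!lt0n !fact_gt0 bin_gt0.
have [s Es] : exists s, B ^+ 3 - B ^+ 2 = 'X * deriv B + s * 'X^(N.+1).
  (* Applying [X d/dX] to [Br] keeps the remainder divisible by ['X^(N.+1)]. Multiplying the result
     by [B] and using [(1 - T) B = 1], up to a remainder, then eliminates [T]. *)
  have dB : 'X * deriv B = 'X * deriv T * B + T * ('X * deriv B) + ('X * deriv r + r *+ N.+1) * 'X^(N.+1).
    rewrite {1}Br !poly.derivE /= -mulr_natr exprS -[r *+ _]mulr_natr; ring.
  have e1 : B - T * B = 1 + r * 'X^(N.+1) by rewrite {1}Br; ring.
  have e2 : (B - 1) * B = 'X * deriv B - T * ('X * deriv B)
      - ('X * deriv r + r *+ N.+1) * 'X^(N.+1) by rewrite {1}dB XT; ring.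
  exists ('X * deriv B * r - B * ('X * deriv r + r *+ N.+1)).
  transitivity ((B - 1) * B * B); first by ring.
  rewrite e2; move: e1; move: ('X * deriv B) (_ + r *+ N.+1) ('X^(N.+1)) => b c y e1.
  transitivity (b * (B - T * B) - c * y * B); first by ring.
  by rewrite e1; ring.
by rewrite Es coefD coefMXn ltnSn addr0.
Qed.

Lemma sum_subsets_card (V : nmodType) (T : finType) (A : {set T}) (G : nat -> V) :
  \sum_(B : {set T} | B \subset A) G #|B| = \sum_(b < #|A|.+1) G b *+ 'C(#|A|, b).
Proof.
rewrite (partition_big (fun B : {set T} => inord #|B| : 'I_(#|A|.+1)) xpredT) //=.
apply: eq_bigr => b _; rewrite -cards_draws -sumr_const.
apply: eq_big => [B|B /andP[BA /eqP <-]].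
  rewrite inE; case BA : (B \subset A) => //=.
  by rewrite -val_eqE /= inordK // ltnS subset_leq_card.
by rewrite inordK // ltnS subset_leq_card.
Qed.

Definition ncolor (m r : nat) (s : {ffun 'I_m -> 'I_r}) (j : 'I_r) : nat :=
  #|[set i | s i == j]|.

(** A colouring by three colours is a nested pair [B \subset A]: [B] holds the first colour, [A] the
    first two. Choosing [A] and then [B] inside it gives the two binomials. *)
Lemma sum_3colorings (V : nmodType) (m : nat) (G : nat -> nat -> nat -> V) :
  \sum_(s : {ffun 'I_m -> 'I_3})
     G (ncolor s ord0) (ncolor s (inord 1)) (ncolor s ord_max) =
  \sum_(a < m.+1) \sum_(b < a.+1) G b (a - b)%N (m - a)%N *+ ('C(m, a) * 'C(a, b)).
Proof.
pose h (p : {set 'I_m} * {set 'I_m}) : {ffun 'I_m -> 'I_3} :=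
  [ffun i => if i \in p.2 then ord0 else if i \in p.1 then inord 1 else ord_max].
pose g (s : {ffun 'I_m -> 'I_3}) := ([set i | s i != ord_max], [set i | s i == ord0]).
have n01 : (inord 1 == ord0 :> 'I_3) = false by rewrite -val_eqE /= inordK.
have n12 : (inord 1 == ord_max :> 'I_3) = false by rewrite -val_eqE /= inordK.
have gK s : h (g s) = s.
  apply/ffunP => i; rewrite ffunE !inE.
  case: eqP => [->//|/eqP s0]; case: eqP => [->//|/eqP s2] /=.
  apply/val_inj; rewrite /= inordK //.
  by move: s0 s2; rewrite -!val_eqE /=; case: (s i) => -[|[|[]]].
(* The new sum ranges over the pairs fixed by [g \o h]; by [hg] these are the nested ones. *)
rewrite (reindex_onto h g) /=; last by move=> s _; exact: gK.
have hg p : (g (h p) == p) = (p.2 \subset p.1).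
  case: p => A B /=; rewrite /g xpair_eqE.
  have -> : [set i | h (A, B) i == ord0] = B.
    by apply/finset.setP => i; rewrite !inE ffunE /=; case: ifP => // _; case: ifP; rewrite // n01.
  rewrite eqxx andbT; have -> : [set i | h (A, B) i != ord_max] = A :|: B.
    apply/finset.setP => i; rewrite !inE ffunE /=; case: (i \in B); rewrite ?orbT ?orbF //.
    by case: (i \in A); rewrite ?n12.
  by apply/eqP/finset.setUidPl.
transitivity (\sum_(A : {set 'I_m}) \sum_(B : {set 'I_m} | B \subset A)
   G #|B| (#|A| - #|B|)%N (m - #|A|)%N).
  rewrite pair_big_dep /=; apply: eq_big => [p|[A B] /=]; first by rewrite hg.
  rewrite hg /= => BA; congr G.
  - by apply: eq_card => i; rewrite !inE ffunE /=; case: ifP => // _; case: ifP; rewrite // n01.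
  - rewrite -cardsDS //; apply: eq_card => i; rewrite !inE ffunE /=.
    by case: (i \in B); case: (i \in A); rewrite //= ?eqxx // eq_sym ?n01 ?n12.
  - transitivity #|~: A|; last by rewrite [LHS]cardsCs finset.setCK card_ord.
    apply: eq_card => i; rewrite !inE ffunE /=.
    have [/(fintype.subsetP BA) ->//|_] := boolP (i \in B).
    by case: (i \in A); rewrite // n12.
under [LHS]eq_bigr => A _ do
  rewrite (sum_subsets_card A (fun b => G b (#|A| - b)%N (m - #|A|)%N)).
rewrite (eq_bigl (fun A : {set 'I_m} => A \subset [set: 'I_m])); last first.
  by move=> A; rewrite finset.subsetT.
rewrite (sum_subsets_card _ (fun a => \sum_(b < a.+1) G b (a - b)%N (m - a)%N *+ 'C(a, b))).
rewrite cardsT card_ord; apply: eq_bigr => a _; rewrite -sumrMnl.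
by apply: eq_bigr => b _; rewrite mulnC mulrnA.
Qed.

(** With [B] the generating polynomial of [n^n/n!], the multinomial counts make the left-hand side
    [(m!/m^m) [z^m] B^3], while [xi m] is [(m!/m^m) [z^m] B^2]. Their difference is [(m!/m^m) [z^m]
    z B' = m]. *)
Lemma sum_3colorings_xi (R : realType) (m : nat) : (0 < m)%N ->
  \sum_(s : {ffun 'I_m -> 'I_3})
    \prod_(j < 3) ((ncolor s j)%:R / m%:R) ^+ (ncolor s j) = xi m + m%:R :> R.
Proof.
move=> m0; have mR : m%:R != 0 :> R by rewrite pnatr_eq0 -lt0n.
have fR n : n`!%:R != 0 :> R by rewrite pnatr_eq0 -lt0n fact_gt0.
pose G a b c : R := (a%:R / m%:R) ^+ a * (b%:R / m%:R) ^+ b * (c%:R / m%:R) ^+ c.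
rewrite (eq_bigr (fun s => G (ncolor s ord0) (ncolor s (inord 1)) (ncolor s ord_max))); last first.
  move=> s _; rewrite !big_ord_recl big_ord0 mulr1 /G mulrA.
  have -> : lift ord0 ord0 = inord 1 :> 'I_3 by apply/val_inj; rewrite /= inordK.
  by have -> : lift ord0 (lift ord0 ord0) = ord_max :> 'I_3 by apply/val_inj.
rewrite sum_3colorings.
pose B := \poly_(n < m.+1) ((n ^ n)%:R / n`!%:R) : {poly R}.
have cB i : (i <= m)%N -> B`_i = i%:R ^+ i / i`!%:R.
  by move=> im; rewrite coef_poly ltnS im natrX.
pose c : R := m`!%:R / m%:R ^+ m.
have B3 : (B ^+ 3)`_m * c = \sum_(a < m.+1) \sum_(b < a.+1) G b (a - b)%N (m - a)%N *+ ('C(m, a) * 'C(a, b)).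
  rewrite exprSr expr2 coefM mulr_suml; apply: eq_bigr => a _.
  have am : (a <= m)%N by rewrite -ltnS.
  rewrite coefM !mulr_suml; apply: eq_bigr => b _.
  have ba : (b <= a)%N by rewrite -ltnS.
  rewrite !cB ?leq_subr ?(leq_trans ba) ?(leq_trans (leq_subr _ _)) //.
  rewrite /G /c -(bin_fact am) -(bin_fact ba) -[RHS]mulr_natr !natrM !expr_div_n.
  have -> : m%:R ^+ m = m%:R ^+ b * m%:R ^+ (a - b) * m%:R ^+ (m - a) :> R.
    by rewrite -!exprD subnKC // subnKC.
  have : m%:R ^+ b != 0 :> R by rewrite expf_neq0.
  have : m%:R ^+ (a - b) != 0 :> R by rewrite expf_neq0.
  have : m%:R ^+ (m - a) != 0 :> R by rewrite expf_neq0.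
  move: (fR b) (fR (a - b)%N) (fR (m - a)%N).
  move: (m%:R ^+ b) (m%:R ^+ (a - b)) (m%:R ^+ (m - a)) (b%:R ^+ b)
    ((a - b)%:R ^+ (a - b)) ((m - a)%:R ^+ (m - a)) => *.
  by field; do ?[apply/andP; split].
have B2 : (B ^+ 2)`_m * c = xi m.
  rewrite expr2 coefM mulr_suml; apply: eq_bigr => k _.
  have km : (k <= m)%N by rewrite -ltnS.
  rewrite !cB ?leq_subr // /c -(bin_fact km) !natrM.
  have -> : 1 - k%:R / m%:R = (m - k)%:R / m%:R :> R by rewrite natrB // mulrBl divff.
  rewrite !expr_div_n.
  have -> : m%:R ^+ m = m%:R ^+ k * m%:R ^+ (m - k) :> R by rewrite -exprD subnKC.
  have : m%:R ^+ k != 0 :> R by rewrite expf_neq0.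
  have : m%:R ^+ (m - k) != 0 :> R by rewrite expf_neq0.
  move: (fR k) (fR (m - k)%N).
  move: (m%:R ^+ k) (m%:R ^+ (m - k)) (k%:R ^+ k) ((m - k)%:R ^+ (m - k)) => *.
  by field; do ?[apply/andP; split].
rewrite -B3 -B2 -[LHS](subrK ((B ^+ 2)`_m * c)) addrC -mulrBl -coefB.
rewrite tree_function_relation coefXM eqn0Ngt m0 /= coef_deriv prednK //.
congr (_ + _); rewrite cB // /c -[_ *+ m]mulr_natr; have : m%:R ^+ m != 0 :> R by rewrite expf_neq0.
by move: (m%:R ^+ m) => x x0; field; rewrite x0 fR.
Qed.

(** * Exponential bound by a sum over colourings *)

(** The tangent line of [expR] at [t = sum_j u_j ln r_j] gives [r_j >= e^t (1 + ln r_j - t)];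
    averaging with the weights [u] cancels the linear terms. *)
Lemma weighted_amgm (R : realType) (n : nat) (u r : 'I_n -> R) :
  (forall j, 0 <= u j) -> \sum_j u j = 1 -> (forall j, 0 < r j) ->
  expR (\sum_j u j * ln (r j)) <= \sum_j u j * r j.
Proof.
move=> u0 u1 r0; set t := \sum_j _.
suff : \sum_j u j * (expR t * (1 + (ln (r j) - t))) <= \sum_j u j * r j.
  apply: le_trans; under eq_bigr => j _ do rewrite mulrCA.
  rewrite -mulr_sumr.
  under eq_bigr => j _ do rewrite addrA mulrDr mulrN mulrDr mulr1 addrAC.
  by rewrite big_split /= sumrB -mulr_suml u1 mul1r -/t subrK mulr1.
apply: ler_sum => j _; apply: ler_wpM2l => //.
have rE : r j = expR (t + (ln (r j) - t)) by rewrite subrKC lnK ?posrE.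
rewrite [leRHS]rE expRD.
by apply: ler_wpM2l; [exact: expR_ge0 | exact: expR_ge1Dx].
Qed.

(** The function [r^k e^(-c r)] is largest at [r = k/c]. With [x = c r / k] the claim becomes
    [(x e^(1 - x))^k <= 1]; the case [k = 0] relies on [0^0 = 1]. *)
Lemma exprn_expR_le (R : realType) (k : nat) (c r : R) : 0 < c -> 0 < r ->
  r ^+ k * expR (k%:R - c * r) <= (k%:R / c) ^+ k.
Proof.
move=> c0 r0; case: k => [|k].
  by rewrite !expr0 mul1r sub0r expR_le1 oppr_le0 mulr_ge0 // ltW.
have k0 : 0 < k.+1%:R :> R by [].
have kc : 0 <= k.+1%:R / c by rewrite divr_ge0 // ltW.
set x := c * r / k.+1%:R.
have -> : r = k.+1%:R / c * x by rewrite /x; field; rewrite gt_eqF //= gt_eqF.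
rewrite [(_ / c * x) ^+ _]exprMn -[leRHS]mulr1 -[leLHS]mulrA; apply: ler_wpM2l; first exact: exprn_ge0.
have -> : k.+1%:R - c * (k.+1%:R / c * x) = (1 - x) * k.+1%:R.
  by field; rewrite gt_eqF.
rewrite expRM_natr -exprMn exprn_ile1 //.
  by rewrite mulr_ge0 ?expR_ge0 // /x divr_ge0 // ltW // mulr_gt0.
have : x <= expR (x - 1) by have := expR_ge1Dx (x - 1); rewrite subrKC.
move=> xe; apply: le_trans (ler_wpM2r (expR_ge0 _) xe) _.
by rewrite -expRD addrA subrK subrr expR0.
Qed.

Lemma prod_ncolor (R : comPzRingType) (m n : nat) (s : {ffun 'I_m -> 'I_n}) (r : 'I_n -> R) :
  \prod_i r (s i) = \prod_j r j ^+ ncolor s j.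
Proof.
rewrite (partition_big s xpredT) //=; apply: eq_bigr => j _.
rewrite (eq_bigr (fun=> r j)); last by move=> i /eqP ->.
by rewrite prodr_const; congr (_ ^+ _); apply: eq_card => i; rewrite inE.
Qed.

Lemma sum_ncolor (m n : nat) (s : {ffun 'I_m -> 'I_n}) : (\sum_j ncolor s j = m)%N.
Proof.
rewrite -[RHS]card_ord -sum1_card (partition_big s xpredT) //=.
by apply: eq_bigr => j _; rewrite sum1_card; apply: eq_card => i; rewrite inE.
Qed.

(** The right-hand side is free of [r], which later lets one event serve all weights. The variable
    [r] is removed colour by colour through [exprn_expR_le] with [c = m p_j]. *)
Lemma expR_le_sum_colorings (R : realType) (m n : nat) (u : 'I_m -> 'I_n -> R)
    (p r : 'I_n -> R) : (0 < m)%N ->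
  (forall i j, 0 <= u i j) -> (forall i, \sum_j u i j = 1) ->
  (forall j, 0 < p j) -> (forall j, 0 < r j) ->
  expR (\sum_i \sum_j u i j * ln (r j) + m%:R * (1 - \sum_j p j * r j)) <=
  \sum_(s : {ffun 'I_m -> 'I_n}) (\prod_i u i (s i)) *
     \prod_j ((ncolor s j)%:R / (m%:R * p j)) ^+ ncolor s j.
Proof.
move=> m0 u0 u1 p0 r0; rewrite expRD expR_sum.
have mR : 0 < m%:R :> R by rewrite ltr0n.
apply: (@le_trans _ _ ((\prod_i \sum_j u i j * r j) * expR (m%:R * (1 - \sum_j p j * r j)))).
  apply: ler_wpM2r; first exact: expR_ge0.
  by apply: ler_prod => i _; rewrite expR_ge0 weighted_amgm.
rewrite bigA_distr_bigA mulr_suml; apply: ler_sum => s _.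
rewrite big_split /= -mulrA; apply: ler_wpM2l; first exact: prodr_ge0.
rewrite prod_ncolor.
(* The [m] of the exponent is shared out among the colour counts, so that the exponential factors
   over the colours. *)
have -> : m%:R * (1 - \sum_j p j * r j) =
    \sum_j ((ncolor s j)%:R - (m%:R * p j) * r j).
  rewrite sumrB -natr_sum sum_ncolor mulrBr mulr1 mulr_sumr.
  by under [in RHS]eq_bigr => j _ do rewrite -mulrA.
rewrite expR_sum -big_split /=; apply: ler_prod => j _.
by rewrite mulr_ge0 ?exprn_ge0 ?expR_ge0 ?(ltW (r0 j)) //= exprn_expR_le // mulr_gt0.
Qed.

Local Open Scope classical_set_scope.
Local Open Scope ring_scope.

(** * Variational bound for the kl divergence *)

Lemma klterm_fin (R : realType) (q p : R) : 0 <= q -> 0 <= p ->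
  ~~ ((q != 0) && (p == 0)) -> klterm q p = (q * ln (q / p))%:E.
Proof.
move=> q0 p0; rewrite /klterm; case: eqP => [->|_]; first by rewrite mul0r.
by rewrite negb_and /= => pn0; rewrite leNgt lt_neqAle eq_sym pn0 p0.
Qed.

(** The divergence is approached by evaluating the hypothesis near the optimal weights
    [r_j = q_j / p_j]. *)
Lemma sum_klterm_le (R : realType) (n : nat) (q p : 'I_n -> R) (C : R) :
  (forall j, 0 <= q j) -> (forall j, 0 <= p j) ->
  \sum_j q j <= 1 -> \sum_j p j <= 1 ->
  (forall r, (forall j, 0 < r j) ->
    \sum_j q j * ln (r j) - \sum_j p j * r j + 1 <= C) ->
  (\sum_j klterm (q j) (p j) <= C%:E)%E.
Proof.
move=> q0 p0 q1 p1 H.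
have [[j /andP[qj pj]]|nex] := pselect (exists j, (q j != 0) && (p j == 0)).
  (* Here [p j = 0] and [q j > 0], so the divergence is infinite. This weight contributes [C + 1]
     through [q j * ln (r j)] and nothing through [p j * r j], against the hypothesis. *)
  pose r i := if i == j then expR ((C + 1) / q j) else 1.
  have := H r; rewrite /r => /(_ _)/wrap[].
    by move=> i; case: ifP => _; rewrite ?expR_gt0.
  have -> : \sum_i q i * ln (if i == j then expR ((C + 1) / q j) else 1) = C + 1.
    rewrite (bigD1 j) //= eqxx expRK big1 ?addr0; last first.
      by move=> i /negPf ->; rewrite ln1 mulr0.
    by field.
  have : \sum_i p i * (if i == j then expR ((C + 1) / q j) else 1) <= 1.
    apply: le_trans p1; apply: ler_sum => i _; case: eqP => [->|_].
      by rewrite (eqP pj) mul0r.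
    by rewrite mulr1.
  move: (\sum_i _) => x x1 h; exfalso; lra.
have kE j : klterm (q j) (p j) = (q j * ln (q j / p j))%:E.
  by apply: klterm_fin => //; apply/negP => h; apply: nex; exists j.
under eq_bigr => j _ do rewrite kE.
rewrite sumEFin lee_fin; apply/ler_addgt0Pr => e e0.
(* Weights must be positive: where [q j = 0], the optimal value 0 is replaced by [e], at a total
   cost of at most [e]. *)
pose r j := if q j == 0 then e else q j / p j.
have r0 j : 0 < r j.
  rewrite /r; case: eqP => // /eqP qj.
  rewrite divr_gt0 // lt_neqAle eq_sym ?qj ?q0 // p0 andbT.
  by apply/negP => pj; apply: nex; exists j; rewrite qj.
have := H r r0.
have -> : \sum_j q j * ln (r j) = \sum_j q j * ln (q j / p j).
  by apply: eq_bigr => j _; rewrite /r; case: eqP => // ->; rewrite !mul0r.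
have : \sum_j p j * r j <= 1 + e.
  apply: (@le_trans _ _ (\sum_j (q j + e * p j))).
    apply: ler_sum => j _; rewrite /r; case: eqP => [->|/eqP qj]; first by rewrite add0r mulrC.
    have pj : p j != 0 by apply/negP => pj; apply: nex; exists j; rewrite qj.
    by rewrite mulrCA divff // mulr1 lerDl mulr_ge0 // ltW.
  rewrite big_split /= -mulr_sumr lerD // -[leRHS]mulr1 ler_wpM2l // ltW //.
move: (\sum_j p j * r j) (\sum_j _) => x y h1 h2; lra.
Qed.

(** * Integrals of bounded functions *)

(** A class stable under sums, products, exponentials and partial integration, whose members are
    integrable for every probability. *)
Definition bounded_measurable {R : realType} {d : measure_display}
  {T : measurableType d} (f : T -> R) : Prop :=
  measurable_fun setT f /\ exists M, forall x, `|f x| <= M.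

Section bounded_measurable_theory.
Context {R : realType} {d : measure_display} {T : measurableType d}.
Implicit Types (f g : T -> R) (P : probability T R).

Lemma bounded_measurable_cst (c : R) : bounded_measurable (fun _ : T => c).
Proof. by split => //; exists `|c|. Qed.

Lemma bounded_measurableD f g : bounded_measurable f -> bounded_measurable g ->
  bounded_measurable (fun x => f x + g x).
Proof.
move=> [mf [M fM]] [mg [N gN]]; split; first exact: measurable_funD.
by exists (M + N) => x; rewrite (le_trans (ler_normD _ _)) // lerD.
Qed.

Lemma bounded_measurableN f : bounded_measurable f ->
  bounded_measurable (fun x => - f x).
Proof.
move=> [mf [M fM]]; split; first exact: measurableT_comp.
by exists M => x; rewrite normrN.
Qed.

Lemma bounded_measurableM f g : bounded_measurable f -> bounded_measurable g ->
  bounded_measurable (fun x => f x * g x).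
Proof.
move=> [mf [M fM]] [mg [N gN]]; split; first exact: measurable_funM.
by exists (M * N) => x; rewrite normrM ler_pM.
Qed.

Lemma bounded_measurable_sum (I : Type) (s : seq I) (f : I -> T -> R) :
  (forall i, bounded_measurable (f i)) ->
  bounded_measurable (fun x => \sum_(i <- s) f i x).
Proof.
move=> bf; split; first by apply: measurable_sum => i; exact: (bf i).1.
have /choice[M fM] i := (bf i).2.
exists (\sum_(i <- s) M i) => x.
by apply: (le_trans (ler_norm_sum _ _ _)); apply: ler_sum => i _; exact: fM.
Qed.

Lemma bounded_measurable_prod (I : eqType) (s : seq I) (f : I -> T -> R) :
  (forall i, bounded_measurable (f i)) ->
  bounded_measurable (fun x => \prod_(i <- s) f i x).
Proof.
move=> bf; split; first by apply: measurable_prod => i _; exact: (bf i).1.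
have /choice[M fM] i := (bf i).2.
exists (\prod_(i <- s) M i) => x.
by rewrite normr_prod; apply: ler_prod => i _; rewrite normr_ge0 fM.
Qed.

Lemma bounded_measurableX f (n : nat) :
  bounded_measurable f -> bounded_measurable (fun x => f x ^+ n).
Proof.
move=> bf; elim: n => [|n IH]; first exact: bounded_measurable_cst.
under eq_fun do rewrite exprS; exact: bounded_measurableM.
Qed.


Lemma bounded_measurable_integrable P f : bounded_measurable f ->
  P.-integrable setT (EFin \o f).
Proof.
move=> [mf [M fM]].
apply: (le_integrable measurableT _ _ (finite_measure_integrable_cst P M measurableT)).
  exact/measurable_EFinP.
by move=> x _ /=; rewrite lee_fin (le_trans (fM x)) // ler_norm.
Qed.

Lemma EFin_Rintegral P f : bounded_measurable f ->
  (\int[P]_x f x)%:E = (\int[P]_x (f x)%:E)%E.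
Proof.
move=> bf; rewrite /Rintegral fineK //.
exact: integrable_fin_num (bounded_measurable_integrable P bf).
Qed.

Lemma le_Rintegral_bounded P f g : bounded_measurable f -> bounded_measurable g ->
  (forall x, f x <= g x) -> \int[P]_x f x <= \int[P]_x g x.
Proof.
move=> bf bg fg; apply: le_Rintegral => //; exact: bounded_measurable_integrable.
Qed.

Lemma Rintegral_probability_cst P (c : R) : \int[P]_x c = c.
Proof.
rewrite Rintegral_cst //; apply: etrans (mulr1 c); congr (_ * _).
by rewrite -[RHS]/(fine 1%E); congr fine; exact: probability_setT.
Qed.

Lemma RintegralD_bounded P f g : bounded_measurable f -> bounded_measurable g ->
  \int[P]_x (f x + g x) = \int[P]_x f x + \int[P]_x g x.
Proof. by move=> bf bg; apply: RintegralD => //; exact: bounded_measurable_integrable. Qed.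

Lemma RintegralZl_bounded P f (c : R) : bounded_measurable f ->
  \int[P]_x (c * f x) = c * \int[P]_x f x.
Proof. by move=> bf; apply: RintegralZl => //; exact: bounded_measurable_integrable. Qed.

Lemma Rintegral_sum_bounded P (I : Type) (s : seq I) (f : I -> T -> R) :
  (forall i, bounded_measurable (f i)) ->
  \int[P]_x (\sum_(i <- s) f i x) = \sum_(i <- s) \int[P]_x f i x.
Proof.
move=> bf; elim: s => [|i s IH].
  by under eq_Rintegral => x _ do rewrite big_nil; rewrite big_nil Rintegral_probability_cst.
under eq_Rintegral => x _ do rewrite big_cons.
rewrite RintegralD_bounded ?IH ?big_cons //; exact: bounded_measurable_sum.
Qed.

End bounded_measurable_theory.

(** * Donsker-Varadhan inequality *)

(** No integrability is assumed: positive parts increase and negative parts decrease. This suits the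
    logarithm of a density, whose integral may be infinite. *)
Lemma le_integral_measurable (R : realType) (d : measure_display)
    (T : measurableType d) (mu : {measure set T -> \bar R}) (f g : T -> \bar R) :
  measurable_fun setT f -> measurable_fun setT g -> (forall x, (f x <= g x)%E) ->
  (\int[mu]_x f x <= \int[mu]_x g x)%E.
Proof.
move=> mf mg fg; rewrite integralE [leRHS]integralE; apply: leeB.
- apply: ge0_le_integral => //; try exact: measurable_funepos.
  by move=> x _; rewrite !funeposE ge_max !le_max fg lexx orbT.
- apply: ge0_le_integral => //; try exact: measurable_funeneg.
  by move=> x _; rewrite !funenegE ge_max !le_max leeN2 fg lexx orbT.
Qed.

Lemma measurable_gt0 (R : realType) (d : measure_display) (T : measurableType d)
  (g : T -> R) : measurable_fun setT g -> measurable_fun setT (fun x => 0 < g x).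
Proof. by move=> mg; apply: measurable_fun_ltr. Qed.

Lemma measurable_lnE (R : realType) (d : measure_display) (T : measurableType d)
    (g : T -> R) : measurable_fun setT g -> measurable_fun setT (fun x => lnE (g x)%:E).
Proof.
move=> mg; apply: measurable_fun_ifT => //; first exact: measurable_gt0.
by apply/measurable_EFinP; apply: measurableT_comp.
Qed.

Lemma bounded_measurable_expR (R : realType) (d : measure_display)
    (T : measurableType d) (f : T -> R) :
  bounded_measurable f -> bounded_measurable (fun x => expR (f x)).
Proof.
move=> [mf [M fM]]; split; first exact: measurableT_comp.
exists (expR M) => x; rewrite ger0_norm ?expR_ge0 // ler_expR.
by rewrite (le_trans (ler_norm _)).
Qed.

Lemma Rintegral_expR_gt0 (R : realType) (d : measure_display)
    (T : measurableType d) (P : probability T R) (f : T -> R) :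
  bounded_measurable f -> 0 < \int[P]_x expR (f x).
Proof.
move=> bf; have [M fM] := bf.2.
apply: (@lt_le_trans _ _ (\int[P]_x (expR (- M)))).
  by rewrite Rintegral_probability_cst expR_gt0.
apply: le_Rintegral_bounded.
- exact: bounded_measurable_cst.
- exact: bounded_measurable_expR.
- by move=> x; rewrite ler_expR lerNl; apply: le_trans (fM x); rewrite -normrN ler_norm.
Qed.

(** Let [g = dQ/dP] and let [K] be the [P]-mean of [e^phi]. The ratio [rho = e^phi / (K g)] has
    [Q]-mean at most 1, and [1 + x <= e^x] reads [ln g >= phi - ln K + 1 - rho]; integrate this
    against [Q]. *)
Lemma donsker_varadhan (R : realType) (d : measure_display) (H : measurableType d)
    (P Q : probability H R) (phi : H -> R) : bounded_measurable phi ->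
  ((\int[Q]_h phi h)%:E <= KL Q P + (ln (\int[P]_h expR (phi h)))%:E)%E.
Proof.
move=> bphi; rewrite /KL; case: pselect => [QP|nQP]; last by rewrite addye // leey.
set f := Radon_Nikodym _ _; set K := \int[P]_h _.
have K0 : 0 < K by exact: Rintegral_expR_gt0.
(* A version of the density that is nonnegative everywhere; it is compared below with the version
   [f] used by [KL]. *)
pose f' := Radon_Nikodym_SigmaFinite.f Q P.
pose g x := fine (f' x).
have f'E x : f' x = (g x)%:E.
  by rewrite /g fineK //; exact: Radon_Nikodym_SigmaFinite.f_fin_num.
have g0 x : 0 <= g x by rewrite -lee_fin -f'E; exact: Radon_Nikodym_SigmaFinite.f_ge0.
have mf' : measurable_fun setT f'.
  by apply: measurable_int; exact: (Radon_Nikodym_SigmaFinite.f_integrable QP).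
have mg : measurable_fun setT g.
  by apply/measurable_EFinP; apply: (eq_measurable_fun f') => // x _; rewrite f'E.
have mphi := bphi.1.
pose lr x := phi x - ln K - ln (g x).
have mlr : measurable_fun setT lr.
  by apply: measurable_funB; [exact: measurable_funB | exact: measurableT_comp].
pose rho x := if 0 < g x then expR (lr x) else 0.
have mrho : measurable_fun setT rho.
  apply: measurable_fun_ifT => //; first exact: measurable_gt0.
  exact: measurableT_comp.
have rho0 x : 0 <= rho x by rewrite /rho; case: ifP => // _; exact: expR_ge0.
(* Only an inequality: [rho] vanishes where [g = 0], a set that [P] may charge. *)
have rho1 : (\int[Q]_x (rho x)%:E <= 1)%E.
  rewrite -(Radon_Nikodym_SigmaFinite.change_of_variables QP) //; last first.
    exact/measurable_EFinP.
  apply: (@le_trans _ _ (\int[P]_x (K^-1 * expR (phi x))%:E)%E).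
    apply: ge0_le_integral => //.
    - by move=> x _; rewrite -/f' f'E -EFinM lee_fin mulr_ge0.
    - by apply: emeasurable_funM => //; exact/measurable_EFinP.
    - apply/measurable_EFinP; apply: measurable_funM => //.
      exact: measurableT_comp.
    - move=> x _; rewrite -/f' f'E -EFinM lee_fin /rho; case: ifP => gx.
        rewrite /lr expRD expRN lnK // -mulrA mulVf ?gt_eqF // mulr1.
        by rewrite expRD expRN lnK // mulrC.
      by rewrite mul0r mulr_ge0 ?invr_ge0 ?expR_ge0 // ltW.
  rewrite -EFin_Rintegral; last first.
    by apply: bounded_measurableM; [exact: bounded_measurable_cst | exact: bounded_measurable_expR].
  by rewrite RintegralZl_bounded ?mulVf ?gt_eqF //; exact: bounded_measurable_expR.
have irho : Q.-integrable setT (EFin \o rho).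
  apply/integrableP; split; first exact/measurable_EFinP.
  under eq_integral => x _ do rewrite gee0_abs ?lee_fin //.
  by rewrite (le_lt_trans rho1) // ltry.
pose h x := phi x - ln K + 1 - rho x.
have bh : bounded_measurable (fun x => phi x - ln K + 1).
  apply: bounded_measurableD; last exact: bounded_measurable_cst.
  by apply: bounded_measurableD => //; exact: bounded_measurable_cst.
have mh : measurable_fun setT h by apply: measurable_funB => //; exact: bh.1.
have inth : ((\int[Q]_x phi x - ln K)%:E <= \int[Q]_x (h x)%:E)%E.
  under eq_integral => x _ do rewrite /h EFinB.
  rewrite integralB //; last exact: (bounded_measurable_integrable Q bh).
  rewrite -EFin_Rintegral // RintegralD_bounded; last 2 first.
  - by apply: bounded_measurableD => //; exact: bounded_measurable_cst.
  - exact: bounded_measurable_cst.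
  rewrite RintegralD_bounded //; last exact: bounded_measurable_cst.
  rewrite !Rintegral_probability_cst.
  have -> : (\int[Q]_x phi x - ln K)%:E = ((\int[Q]_x phi x - ln K + 1)%:E - 1)%E.
    by rewrite -EFinB addrK.
  by rewrite leeB.
have mA : measurable [set x | ~~ (0 < g x)].
  have := measurable_gt0 mg measurableT (_ : measurable [set false]).
  move=> /(_ Logic.I); rewrite setTI.
  rewrite (_ : [set x | _] = (fun x => 0 < g x) @^-1` [set false]) //.
  by apply/seteqP; split => x /=; [move/negPf | move=> ->].
have Qg0 : Q [set x | ~~ (0 < g x)] = 0%E.
  rewrite (Radon_Nikodym_SigmaFinite.f_integral QP) //.
  apply: integral0_eq => x /= gx; rewrite -/f' f'E; congr EFin.
  by apply/eqP; rewrite eq_le g0 leNgt gx.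
(* On the [Q]-null set where [g = 0], [lam] takes the value of [h], so that [h <= lam] holds
   everywhere. *)
pose lam x := if 0 < g x then (ln (g x))%:E else (h x)%:E.
have mlam : measurable_fun setT lam.
  apply: measurable_fun_ifT => //; first exact: measurable_gt0.
    by apply/measurable_EFinP; exact: measurableT_comp.
  exact/measurable_EFinP.
have -> : (\int[Q]_x lnE (f x) = \int[Q]_x lam x)%E.
  have mf : measurable_fun setT (fun x => fine (f x)).
    apply: measurableT_comp => //.
    by apply: (measurable_int P); apply: Radon_Nikodym_integrable; exact: QP.
  apply: (@ae_eq_integral _ _ _ Q setT lam (fun x => lnE (f x))) => //.
    apply: (eq_measurable_fun (fun x => lnE (fine (f x))%:E)); last exact: measurable_lnE.
    by move=> x _; rewrite fineK //; exact: Radon_Nikodym_fin_num.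
  (* Equality [P]-almost everywhere passes to [Q] by absolute continuity. *)
  have ff : ae_eq Q setT f' f.
    exact: null_dominates_ae_eq measurableT QP (ae_eq_Radon_Nikodym_SigmaFinite QP measurableT).
  have gpos : {ae Q, forall x, 0 < g x}.
    exists [set x | ~~ (0 < g x)]; split => //.
    by move=> x /= /negP.
  apply: filterS2 ff gpos => x fx gx _.
  by rewrite /lam -fx // f'E /lnE gx.
rewrite -leeBlDr // -EFinB; apply: le_trans inth _.
apply: le_integral_measurable => //; first exact/measurable_EFinP.
move=> x; rewrite /lam; case: ifP => // gx; rewrite lee_fin /h /rho gx.
by have := expR_ge1Dx (lr x); rewrite /lr; lra.
Qed.

(** * Iterated integrals of bounded functions *)

Lemma bounded_measurable_comp (R : realType) (d d' : measure_display)
    (T : measurableType d) (T' : measurableType d') (f : T' -> R) (g : T -> T') :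
  bounded_measurable f -> measurable_fun setT g ->
  bounded_measurable (fun x => f (g x)).
Proof.
move=> [mf [M fM]] mg; split; first exact: measurableT_comp.
by exists M => x.
Qed.

Lemma norm_Rintegral_le (R : realType) (d : measure_display)
    (T : measurableType d) (P : probability T R) (f : T -> R) (M : R) :
  bounded_measurable f -> (forall x, `|f x| <= M) -> `|\int[P]_x f x| <= M.
Proof.
move=> bf fM; rewrite ler_norml -{1}(Rintegral_probability_cst P (- M)).
rewrite -{2}(Rintegral_probability_cst P M); apply/andP; split;
  apply: le_Rintegral_bounded => //; try exact: bounded_measurable_cst.
- by move=> x; have := fM x; rewrite ler_norml => /andP[].
- by move=> x; have := fM x; rewrite ler_norml => /andP[].
Qed.

Section bounded_fubini.
Context {R : realType} {d1 d2 : measure_display}.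
Context {T1 : measurableType d1} {T2 : measurableType d2}.
Implicit Types (f : T1 * T2 -> R).

Lemma bounded_measurable_pair1 f x : bounded_measurable f ->
  bounded_measurable (fun y => f (x, y)).
Proof. by move=> bf; apply: bounded_measurable_comp bf _; exact: measurable_pair1. Qed.

Lemma bounded_measurable_pair2 f y : bounded_measurable f ->
  bounded_measurable (fun x => f (x, y)).
Proof. by move=> bf; apply: bounded_measurable_comp bf _; exact: measurable_pair2. Qed.

Lemma bounded_measurable_Rintegral (P : probability T2 R) f : bounded_measurable f ->
  bounded_measurable (fun x => \int[P]_y f (x, y)).
Proof.
move=> bf; have [mf [M fM]] := bf; split; last first.
  exists M => x; apply: norm_Rintegral_le => //; exact: bounded_measurable_pair1.
(* Adding [M] makes the integrand nonnegative, so that Tonelli's theorem gives measurability of the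
   partial integral. *)
have fM0 z : (0 <= (f z + M)%:E)%E.
  by have := fM z; rewrite ler_norml lee_fin -lerBlDr sub0r => /andP[].
have mfM : measurable_fun setT (fun z => (f z + M)%:E).
  by apply/measurable_EFinP; exact: measurable_funD.
have := measurable_fun_fubini_tonelli_F (m2 := P) _ mfM fM0.
rewrite /fubini_F => mF.
apply: (eq_measurable_fun (fun x => fine (\int[P]_y (f (x, y) + M)%:E)%E - M)).
  move=> x _; rewrite -/(Rintegral _ _ _) RintegralD_bounded.
  - by rewrite Rintegral_probability_cst addrK.
  - exact: bounded_measurable_pair1.
  - exact: bounded_measurable_cst.
by apply: measurable_funB => //; apply: measurableT_comp.
Qed.

Lemma Rintegral2_fine (P : probability T1 R) (Q : probability T2 R) f :
  bounded_measurable f ->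
  fine (\int[P]_x \int[Q]_y (f (x, y))%:E)%E = \int[P]_x \int[Q]_y f (x, y).
Proof.
move=> bf; rewrite [RHS]/Rintegral; congr fine; apply: eq_integral => x _.
by rewrite EFin_Rintegral //; exact: bounded_measurable_pair1.
Qed.

Lemma Rintegral_fubini (P : probability T1 R) (Q : probability T2 R) f :
  bounded_measurable f -> (forall z, 0 <= f z) ->
  \int[P]_x \int[Q]_y f (x, y) = \int[Q]_y \int[P]_x f (x, y).
Proof.
move=> bf f0; rewrite -Rintegral2_fine // (fubini_tonelli (fun z => (f z)%:E)) //; last first.
  by apply/measurable_EFinP; exact: bf.1.
rewrite [RHS]/Rintegral; congr fine; apply: eq_integral => y _.
by rewrite EFin_Rintegral //; exact: bounded_measurable_pair2.
Qed.

Definition Rintegral2 (P : probability T1 R) (Q : probability T2 R) f : R :=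
  \int[P]_x \int[Q]_y f (x, y).

Variables (P : probability T1 R) (Q : probability T2 R).

Lemma Rintegral2_ge0 f : (forall z, 0 <= f z) -> 0 <= Rintegral2 P Q f.
Proof. by move=> f0; apply: Rintegral_ge0 => x _; exact: Rintegral_ge0. Qed.

Lemma Rintegral2_cst (c : R) : Rintegral2 P Q (fun=> c) = c.
Proof.
rewrite /Rintegral2 -[RHS](Rintegral_probability_cst P); apply: eq_Rintegral => x _.
exact: Rintegral_probability_cst.
Qed.

Lemma Rintegral2D f g : bounded_measurable f -> bounded_measurable g ->
  Rintegral2 P Q (fun z => f z + g z) = Rintegral2 P Q f + Rintegral2 P Q g.
Proof.
move=> bf bg; rewrite -RintegralD_bounded; last 2 first.
- exact: bounded_measurable_Rintegral.
- exact: bounded_measurable_Rintegral.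
apply: eq_Rintegral => x _; rewrite RintegralD_bounded //;
  exact: bounded_measurable_pair1.
Qed.

Lemma Rintegral2Z (c : R) f : bounded_measurable f ->
  Rintegral2 P Q (fun z => c * f z) = c * Rintegral2 P Q f.
Proof.
move=> bf; rewrite -RintegralZl_bounded; last exact: bounded_measurable_Rintegral.
apply: eq_Rintegral => x _; rewrite RintegralZl_bounded //.
exact: bounded_measurable_pair1.
Qed.

Lemma Rintegral2_sum (I : Type) (s : seq I) (f : I -> T1 * T2 -> R) :
  (forall i, bounded_measurable (f i)) ->
  Rintegral2 P Q (fun z => \sum_(i <- s) f i z) = \sum_(i <- s) Rintegral2 P Q (f i).
Proof.
move=> bf; rewrite -Rintegral_sum_bounded; last first.
  by move=> i; exact: bounded_measurable_Rintegral.
apply: eq_Rintegral => x _; rewrite Rintegral_sum_bounded // => i.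
exact: bounded_measurable_pair1.
Qed.

Lemma sum_Rintegral2_eq1 (n : nat) (f : 'I_n -> T1 * T2 -> R) :
  (forall j, bounded_measurable (f j)) -> (forall z, \sum_j f j z = 1) ->
  \sum_j Rintegral2 P Q (f j) = 1.
Proof.
move=> bf f1; rewrite -Rintegral2_sum // -[RHS]Rintegral2_cst.
by congr Rintegral2; apply/funext.
Qed.

End bounded_fubini.

Lemma bounded_measurable_ln (R : realType) (d : measure_display)
    (T : measurableType d) (f : T -> R) (c : R) : 0 < c ->
  bounded_measurable f -> (forall x, c <= f x) ->
  bounded_measurable (fun x => ln (f x)).
Proof.
move=> c0 [mf [M fM]] cf; split; first exact: measurableT_comp.
have fpos x : 0 < f x := lt_le_trans c0 (cf x).
exists (`|ln c| + `|ln M|) => x; rewrite ler_norml; apply/andP; split.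
  have : ln c <= ln (f x) by rewrite ler_ln ?posrE.
  by have := ler_norm (- ln c); rewrite normrN; have := normr_ge0 (ln M); lra.
have fxM : f x <= M := le_trans (ler_norm _) (fM x).
have : ln (f x) <= ln M by rewrite ler_ln ?posrE // (lt_le_trans (fpos x)).
by have := ler_norm (ln M); have := normr_ge0 (ln c); lra.
Qed.

Lemma bounded_measurable_inv (R : realType) (d : measure_display)
    (T : measurableType d) (f : T -> R) (c : R) : 0 < c ->
  bounded_measurable f -> (forall x, c <= f x) ->
  bounded_measurable (fun x => (f x)^-1).
Proof.
move=> c0 bf cf.
have fpos x : 0 < f x := lt_le_trans c0 (cf x).
have -> : (fun x => (f x)^-1) = fun x => expR (-1 * ln (f x)).
  by apply/funext => x; rewrite mulN1r expRN lnK ?posrE.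
apply: bounded_measurable_expR; apply: bounded_measurableM.
  exact: bounded_measurable_cst.
exact: bounded_measurable_ln c0 bf cf.
Qed.

(** * Donsker-Varadhan inequality for pairs *)

Lemma KL_ge0 (R : realType) (d : measure_display) (H : measurableType d)
  (P Q : probability H R) : (0 <= KL Q P)%E.
Proof.
have := donsker_varadhan P Q (bounded_measurable_cst (T := H) (0 : R)).
rewrite expR0 !Rintegral_probability_cst ln1 adde0; exact.
Qed.

(** At fixed [h1] the inequality bounds the inner mean by [k + psi h1]; applied again to [psi] it
    gives the second [k]. As [psi] is the logarithm of the inner prior integral, its exponential
    restores the double integral. *)
Lemma donsker_varadhan2 (R : realType) (d : measure_display) (H : measurableType d)
    (P Q : probability H R) (phi : H * H -> R) (k : R) :
  bounded_measurable phi -> KL Q P = k%:E ->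
  \int[Q]_h1 \int[Q]_h2 phi (h1, h2) <=
  2 * k + ln (\int[P]_h1 \int[P]_h2 expR (phi (h1, h2))).
Proof.
move=> bphi KLk.
have DV f : bounded_measurable f ->
    \int[Q]_h f h <= k + ln (\int[P]_h expR (f h)).
  by move=> bf; have := donsker_varadhan P Q bf; rewrite KLk -EFinD lee_fin.
have bexp := bounded_measurable_expR bphi.
pose psi h1 := ln (\int[P]_h2 expR (phi (h1, h2))).
have [M fM] := bphi.2.
have bpsi : bounded_measurable psi.
  apply: (@bounded_measurable_ln _ _ _ _ (expR (- M))); first exact: expR_gt0.
    exact: (bounded_measurable_Rintegral P bexp).
  move=> x; rewrite -[leLHS](Rintegral_probability_cst P).
  apply: le_Rintegral_bounded; first exact: bounded_measurable_cst.
    exact: bounded_measurable_pair1 bexp.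
  by move=> y; rewrite ler_expR; have := fM (x, y); rewrite ler_norml => /andP[].
apply: (@le_trans _ _ (\int[Q]_h1 (k + psi h1))).
  apply: le_Rintegral_bounded.
  - exact: bounded_measurable_Rintegral.
  - by apply: bounded_measurableD => //; exact: bounded_measurable_cst.
  - by move=> h1; apply: DV; exact: bounded_measurable_pair1.
rewrite RintegralD_bounded //; last exact: bounded_measurable_cst.
rewrite Rintegral_probability_cst.
have := DV psi bpsi.
have -> : \int[P]_h expR (psi h) = \int[P]_h1 \int[P]_h2 expR (phi (h1, h2)).
  apply: eq_Rintegral => h _; rewrite /psi lnK // posrE.
  by apply: Rintegral_expR_gt0; exact: bounded_measurable_pair1.
lra.
Qed.

(** * Independent samples *)

Import HBNNSimple.

(** By [fB], the image under [S] of the measure with density [f] is [c * nu]. Linearity passes from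
    indicators to simple functions, monotone convergence to [g]. *)
Lemma integral_comp_density (R : realType) (d d' : measure_display)
    (T : measurableType d) (T' : measurableType d')
    (mu : {measure set T -> \bar R}) (nu : {measure set T' -> \bar R})
    (S : T -> T') (f : T -> R) (c : R) (g : T' -> R) :
  measurable_fun setT S -> measurable_fun setT f -> (forall x, 0 <= f x) ->
  0 <= c ->
  (forall B, measurable B ->
     (\int[mu]_x (f x * \1_B (S x))%:E = c%:E * nu B)%E) ->
  measurable_fun setT g -> (forall y, 0 <= g y) ->
  (\int[mu]_x (f x * g (S x))%:E = c%:E * \int[nu]_y (g y)%:E)%E.
Proof.
move=> mS mf f0 c0 fB mg g0.
have mg' : measurable_fun setT (EFin \o g) by apply/measurable_EFinP.
pose h := nnsfun_approx measurableT mg'.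
have hg y : h n y @[n --> \oo] --> g y.
  have h0 z : [set: T'] z -> (0 <= (EFin \o g) z)%E by rewrite lee_fin.
  have := @cvg_nnsfun_approx _ _ _ _ measurableT _ mg' h0 y Logic.I.
  by move/fine_cvgP => [].
have hm a b y : (a <= b)%N -> h a y <= h b y.
  by move=> ab; exact/lefP/nd_nnsfun_approx.
have cnu : (c%:E * \int[nu]_y (h n y)%:E)%E @[n --> \oo] --> (c%:E * \int[nu]_y (g y)%:E)%E.
  apply: cvgeZl => //.
  have -> : (\int[nu]_y (g y)%:E = \int[nu]_y limn (fun n => (h n y)%:E))%E.
    apply: eq_integral => y _; apply/esym/cvg_lim => //.
    by apply/cvg_EFin; [exact: nearW | exact: hg].
  apply: cvg_monotone_convergence => //.
  - by move=> n; exact/measurable_EFinP.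
  - by move=> n y _; rewrite lee_fin.
  - by move=> y _ a b ab; rewrite lee_fin hm.
have cmu : (\int[mu]_x (f x * h n (S x))%:E)%E @[n --> \oo] --> (\int[mu]_x (f x * g (S x))%:E)%E.
  have -> : (\int[mu]_x (f x * g (S x))%:E = \int[mu]_x limn (fun n => (f x * h n (S x))%:E))%E.
    apply: eq_integral => x _; apply/esym/cvg_lim => //.
    apply/cvg_EFin; first exact: nearW.
    by apply: cvgMr; exact: hg.
  apply: cvg_monotone_convergence => //.
  - move=> n; apply/measurable_EFinP; apply: measurable_funM => //.
    exact: measurableT_comp.
  - by move=> n x _; rewrite lee_fin mulr_ge0.
  - by move=> x _ a b ab; rewrite lee_fin ler_wpM2l // hm.
suff E n : (\int[mu]_x (f x * h n (S x))%:E = c%:E * \int[nu]_y (h n y)%:E)%E.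
  rewrite -(cvg_lim (@ereal_hausdorff R) cmu) -(cvg_lim (@ereal_hausdorff R) cnu).
  by under eq_fun do rewrite E.
have mpre r : measurable (h n @^-1` [set r]) by exact: measurable_sfunP.
transitivity (\int[mu]_x (\sum_(r \in range (h n)) (r * (f x * \1_(h n @^-1` [set r]) (S x)))%:E))%E.
  apply: eq_integral => x _; rewrite (fimfunE (h n) (S x)) fsumEFin //; congr EFin.
  by rewrite mulr_fsumr //; apply: eq_fsbigr => r _; rewrite mulrCA.
have mB (B : set T') : measurable B -> measurable_fun setT (fun x => f x * \1_B (S x)).
  move=> mB; apply: measurable_funM => //.
  by apply: (measurableT_comp (measurable_indic mB)).
rewrite ge0_integral_fsum //; last 2 first.
- by move=> r; apply/measurable_EFinP; apply: measurable_funM => //; exact: mB.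
- move=> r x _; have [r0|r0] := leP 0 r; first by rewrite lee_fin !mulr_ge0.
  by rewrite preimage_nnfun0 // indic0 !mulr0.
rewrite integral_nnsfun // patch_setT sintegralE ge0_mule_fsumr; last first.
  by move=> r; exact: nnsfun_mulemu_ge0.
apply: eq_fsbigr => r; rewrite inE => -[y _ yr].
have r0 : 0 <= r by rewrite -yr.
under eq_integral => x _ do rewrite EFinM.
rewrite ge0_integralZl //; last 2 first.
- by apply/measurable_EFinP; exact: mB.
- by move=> x _; rewrite lee_fin mulr_ge0.
by rewrite fB // muleCA.
Qed.

(** Independence is given for events, that is, for products of indicators. Indicators are exchanged
    for functions one coordinate at a time. *)
Lemma expectation_prod_iid (R : realType) (dO dZ : measure_display)
    (Omega : measurableType dO) (Z : measurableType dZ)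
    (Pr : probability Omega R) (D : probability Z R) (m : nat)
    (S : 'I_m -> Omega -> Z) (g : 'I_m -> Z -> R) :
  iid_sample Pr D S ->
  (forall i, measurable_fun setT (g i)) -> (forall i z, 0 <= g i z <= 1) ->
  (\int[Pr]_w (\prod_i g i (S i w))%:E = \prod_i \int[D]_z (g i z)%:E)%E.
Proof.
move=> [mS iid] mg g01.
(* At stage [k] the factors of index at least [k] are indicators: stage 0 is independence itself,
   and stage [m] is the claim. *)
suff H k : forall g : 'I_m -> Z -> R, (forall i, measurable_fun setT (g i)) ->
    (forall i z, 0 <= g i z <= 1) ->
    (forall i : 'I_m, (k <= i)%N -> exists2 B, measurable B & g i = \1_B) ->
    (\int[Pr]_w (\prod_i g i (S i w))%:E = \prod_i \int[D]_z (g i z)%:E)%E.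
  by apply: (H m) => // i; rewrite leqNgt ltn_ord.
elim: k => {mg g01}[|k IH] {}g mg g01 gB.
  have /choice[B BP] : forall i, exists B, measurable B /\ g i = \1_B.
    by move=> i; have [B mB gE] := gB i isT; exists B.
  transitivity (\int[Pr]_w (\1_(\bigcap_(i in [set: 'I_m]) (S i @^-1` B i)) w)%:E)%E.
    apply: eq_integral => w _; congr EFin; rewrite indicE.
    have [/set_mem h|] := boolP (w \in _).
      by rewrite big1 // => i _; rewrite (BP i).2 indicE mem_set //; exact: h.
    move=> /negP h.
    have [i ni] : exists i, ~ B i (S i w).
      by apply/existsNP => H; apply: h; apply/mem_set => i _; exact: H.
    by rewrite (bigD1 i) //= (BP i).2 indicE memNset // mul0r.
  rewrite integral_indic // ?setIT; last first.
    apply: fin_bigcap_measurable => // i _; rewrite -[X in measurable X]setTI.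
    by apply: mS => //; exact: (BP i).1.
  apply: etrans (iid B (fun i => (BP i).1)) _.
  apply: eq_bigr => i _; rewrite (BP i).2 integral_indic ?setIT //.
  exact: (BP i).1.
have [mk|km] := leqP m k.
  apply: IH => // i ki; have := ltn_ord i; by rewrite ltnNge (leq_trans mk ki).
pose ik := Ordinal km.
have bg i : bounded_measurable (g i).
  split; [exact: mg | exists 1 => z]; have /andP[g0 g1] := g01 i z.
  by rewrite ger0_norm.
(* The other factors form the density in [integral_comp_density], with [c] the product of their
   means. The hypothesis on indicators is then [IH], factor [k] having become an indicator. *)
pose f w := \prod_(i | i != ik) g i (S i w).
pose c := \prod_(i | i != ik) \int[D]_z g i z.
have c0 : 0 <= c.
  by apply: prodr_ge0 => i _; apply: Rintegral_ge0 => z _; case/andP: (g01 i z).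
have f0 w : 0 <= f w by apply: prodr_ge0 => i _; case/andP: (g01 i (S i w)).
have mf : measurable_fun setT f.
  have -> : f = fun w => \prod_i (if i != ik then g i (S i w) else 1).
    by apply/funext => w; rewrite /f big_mkcond.
  apply: measurable_prod => i _; case: (i != ik) => //.
  by apply: measurableT_comp.
have -> : (\prod_i \int[D]_z (g i z)%:E = c%:E * \int[D]_z (g ik z)%:E)%E.
  rewrite (bigD1 ik) //= muleC /c -prodEFin; congr (_ * _)%E.
  by apply: eq_bigr => i _; rewrite EFin_Rintegral.
rewrite -(integral_comp_density (mu := Pr) (S := S ik) (f := f)) //.
- by apply: eq_integral => w _; rewrite (bigD1 ik) //= mulrC.
- move=> B mB.
  pose g' i := if i == ik then \1_B : Z -> R else g i.
  transitivity (\int[Pr]_w (\prod_i g' i (S i w))%:E)%E.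
    apply: eq_integral => w _; rewrite (bigD1 ik) //= /g' eqxx mulrC; congr (_ * _)%:E.
    by apply: eq_bigr => i /negPf ->.
  rewrite IH.
  + rewrite (bigD1 ik) //= {1}/g' eqxx integral_indic // setIT muleC; congr (_ * _)%E.
    rewrite /c -prodEFin; apply: eq_bigr => i ni.
    by rewrite /g' (negPf ni) EFin_Rintegral.
  + by move=> i; rewrite /g'; case: ifP.
  + move=> i z; rewrite /g'; case: ifP => // _; rewrite indicE.
    by case: (_ \in _) => /=; rewrite ?lexx ler01.
  + move=> i ki; rewrite /g'; case: eqP => [_|ni]; first by exists B.
    apply: gB; rewrite ltn_neqAle ki andbT; apply/eqP => e; apply: ni.
    exact/val_inj.
- by move=> z; case/andP: (g01 ik z).
Qed.

(** * The PAC-Bayesian bound *)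

Lemma markov_bounded (R : realType) (d : measure_display) (T : measurableType d)
    (P : probability T R) (f : T -> R) (c delta : R) :
  bounded_measurable f -> (forall x, 0 <= f x) -> 0 < c -> 0 < delta ->
  \int[P]_x f x <= c ->
  measurable [set x | f x <= c / delta] /\
  ((1 - delta)%:E <= P [set x | (f x <= c / delta)%R])%E.
Proof.
move=> bf f0 c0 d0 fc; set A := [set x | _].
have mA : measurable A.
  rewrite -[A]setTI; have := @measurable_fun_ler _ _ _ setT f (cst (c / delta)) bf.1.
  move=> /(_ (measurable_cst _) measurableT [set true] Logic.I).
  by rewrite /preimage /A /=.
split => //.
have cd0 : 0 < c / delta by rewrite divr_gt0.
have bind : bounded_measurable (\1_(~` A) : T -> R).
  split; first exact/measurable_indic/measurableC.
  by exists 1 => x; rewrite indicE; case: (_ \in _); rewrite ?normr1 ?normr0.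
have h : (c / delta) * \int[P]_x \1_(~` A) x <= c.
  rewrite -RintegralZl_bounded //; apply: le_trans fc.
  apply: le_Rintegral_bounded => //.
    by apply: bounded_measurableM => //; exact: bounded_measurable_cst.
  move=> x; rewrite indicE; have [/set_mem/= /negP|_] := boolP (x \in ~` A).
    by rewrite mulr1 -ltNge => /ltW.
  by rewrite mulr0.
have PA : (P (~` A) <= delta%:E)%E.
  have -> : P (~` A) = (\int[P]_x \1_(~` A) x)%:E.
    by rewrite EFin_Rintegral // integral_indic ?setIT //; exact: measurableC.
  rewrite lee_fin; move: h; rewrite -mulrA -[leRHS]mulr1 ler_pM2l //.
  by rewrite mulrC ler_pdivrMr // mul1r.
have := probability_setC P (measurableC mA); rewrite setCK => ->.
by rewrite EFinB; apply: leeB.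
Qed.

Section pac_bayes_colorings.
Context {R : realType} {dZ dH dO : measure_display}.
Context {Z : measurableType dZ} {H : measurableType dH} {Omega : measurableType dO}.
Variables (n m : nat) (u : 'I_n -> (H * H) * Z -> R).
Hypothesis bu : forall j, bounded_measurable (u j).
Hypothesis u_ge0 : forall j x, 0 <= u j x.
Hypothesis u_sum1 : forall x, \sum_j u j x = 1.
Variables (D : probability Z R) (P : probability H R) (Pr : probability Omega R).
Variable S : 'I_m -> Omega -> Z.
Hypothesis m_gt0 : (0 < m)%N.
Hypothesis S_iid : iid_sample Pr D S.

Let p j h := \int[D]_z u j (h, z).

(* [p j h] may vanish, hence the regularization by [e > 0]; as [U e] increases
   when [e] decreases, the good events for [e = 1/k] are nested. *)
Let weight (e : R) (s : {ffun 'I_m -> 'I_n}) h :=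
  \prod_j ((ncolor s j)%:R / (m%:R * (p j h + e))) ^+ ncolor s j.

(** The right-hand side of [expR_le_sum_colorings] for a random sample and a pair of voters, with
    [p] raised by [e]. *)
Let U (e : R) (x : Omega * (H * H)) :=
  \sum_(s : {ffun 'I_m -> 'I_n})
    (\prod_i u (s i) (x.2, S i x.1)) * weight e s x.2.

Let mS i : measurable_fun setT (S i). Proof. by case: S_iid. Qed.

Let bp j : bounded_measurable (p j).
Proof. exact: (bounded_measurable_Rintegral D (bu j)). Qed.

Let p_ge0 j h : 0 <= p j h.
Proof. by apply: Rintegral_ge0 => z _; exact: u_ge0. Qed.

Let u_le1 j x : u j x <= 1.
Proof. by rewrite -(u_sum1 x) (bigD1 j) //= lerDl sumr_ge0. Qed.

Let mR : 0 < m%:R :> R. Proof. by rewrite ltr0n. Qed.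

Let weight_ge0 e s h : 0 < e -> 0 <= weight e s h.
Proof.
move=> e0; apply: prodr_ge0 => j _; apply/exprn_ge0/divr_ge0 => //.
by rewrite mulr_ge0 ?(ltW mR) // addr_ge0 ?p_ge0 // ltW.
Qed.

Let bweight e s : 0 < e -> bounded_measurable (weight e s).
Proof.
move=> e0; apply: bounded_measurable_prod => j; apply: bounded_measurableX.
apply: bounded_measurableM; first exact: bounded_measurable_cst.
apply: (@bounded_measurable_inv _ _ _ _ (m%:R * e)); first exact: mulr_gt0.
  apply: bounded_measurableM; first exact: bounded_measurable_cst.
  by apply: bounded_measurableD => //; exact: bounded_measurable_cst.
by move=> h; rewrite ler_pM2l // lerDr.
Qed.

Let bU e : 0 < e -> bounded_measurable (U e).
Proof.
move=> e0; apply: bounded_measurable_sum => s; apply: bounded_measurableM.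
  apply: bounded_measurable_prod => i; apply: bounded_measurable_comp (bu (s i)) _.
  apply: measurable_fun_pair => //.
  exact: (measurableT_comp (mS i) measurable_fst).
exact: bounded_measurable_comp (bweight s e0) measurable_snd.
Qed.

Let U_ge0 e x : 0 < e -> 0 <= U e x.
Proof.
by move=> e0; apply: sumr_ge0 => s _; rewrite mulr_ge0 ?weight_ge0 ?prodr_ge0.
Qed.

Variable C : R.
Hypothesis C_gt0 : 0 < C.
Hypothesis sum_colorings : \sum_(s : {ffun 'I_m -> 'I_n})
  \prod_j ((ncolor s j)%:R / m%:R) ^+ ncolor s j = C.

(** By independence, the product along [s] has mean [prod_j p_j^(k_j)], which cancels the
    denominators of [weight] up to factors [p_j / (p_j + e) <= 1]. *)
Let expectation_U e h : 0 < e -> \int[Pr]_w U e (w, h) <= C.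
Proof.
move=> e0; rewrite -sum_colorings.
have bprod s : bounded_measurable (fun w => \prod_i u (s i) (h, S i w)).
  apply: bounded_measurable_prod => i; apply: bounded_measurable_comp (bu (s i)) _.
  exact: measurable_fun_pair.
rewrite /U /= Rintegral_sum_bounded; last first.
  by move=> s; apply: bounded_measurableM; [exact: bprod | exact: bounded_measurable_cst].
apply: ler_sum => s _ /=.
under eq_Rintegral => w _ do rewrite mulrC.
rewrite RintegralZl_bounded //.
have -> : \int[Pr]_w \prod_i u (s i) (h, S i w) = \prod_j p j h ^+ ncolor s j.
  rewrite -prod_ncolor.
  have bui i : bounded_measurable (fun z => u (s i) (h, z)).
    exact: bounded_measurable_pair1 (bu (s i)).
  rewrite /Rintegral (expectation_prod_iid (g := fun i z => u (s i) (h, z)) S_iid).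
  - rewrite (eq_bigr (fun i => (p (s i) h)%:E)) ?prodEFin // => i _.
    exact/esym/(EFin_Rintegral D (bui i)).
  - by move=> i; exact: (bui i).1.
  - by move=> i z; rewrite u_ge0 u_le1.
rewrite /weight -big_split /=; apply: ler_prod => j _.
have pe : 0 < p j h + e by rewrite ltr_wpDl // p_ge0.
rewrite -exprMn mulrAC; apply/andP; split.
  by rewrite exprn_ge0 // mulr_ge0 ?invr_ge0 ?mulr_ge0 ?p_ge0 // ltW.
apply: lerXn2r; rewrite ?nnegrE.
- by rewrite mulr_ge0 ?invr_ge0 ?mulr_ge0 ?p_ge0 // ltW.
- by rewrite divr_ge0 // ltW.
rewrite invfM mulrACA ler_piMr ?divr_ge0 ?(ltW mR) //.
by rewrite ler_pdivrMr // mul1r lerDl ltW.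
Qed.

Let G e w := \int[P]_h1 \int[P]_h2 U e (w, (h1, h2)).

Let bU1 e : 0 < e ->
  bounded_measurable (fun x : Omega * H => \int[P]_h2 U e (x.1, (x.2, h2))).
Proof.
move=> e0; apply: (bounded_measurable_Rintegral P
  (f := fun y : (Omega * H) * H => U e (y.1.1, (y.1.2, y.2)))).
apply: bounded_measurable_comp (bU e0) _.
apply: measurable_fun_pair; first exact: measurableT_comp.
by apply: measurable_fun_pair => //; exact: measurableT_comp.
Qed.

Let bG e : 0 < e -> bounded_measurable (G e).
Proof. by move=> e0; exact: (bounded_measurable_Rintegral P (bU1 e0)). Qed.

(** The prior does not depend on the sample, so Fubini moves the sample mean inside both prior
    integrals, where [expectation_U] applies. *)
Let expectation_G e : 0 < e -> \int[Pr]_w G e w <= C.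
Proof.
move=> e0; rewrite (Rintegral_fubini Pr P (bU1 e0)); last first.
  by move=> x; apply: Rintegral_ge0 => h _; exact: U_ge0.
rewrite -[leRHS](Rintegral_probability_cst P).
have bU2 h1 : bounded_measurable (fun x : Omega * H => U e (x.1, (h1, x.2))).
  apply: bounded_measurable_comp (bU e0) _.
  apply: measurable_fun_pair => //.
  by apply: measurable_fun_pair.
have E h1 : \int[Pr]_w \int[P]_h2 U e (w, (h1, h2)) = \int[P]_h2 \int[Pr]_w U e (w, (h1, h2)).
  by apply: (Rintegral_fubini Pr P (bU2 h1)) => x; exact: U_ge0.
apply: le_Rintegral_bounded => /=.
- have := bounded_measurable_comp (bU1 e0) (@measurable_swap _ _ H Omega).
  by move=> /(bounded_measurable_Rintegral Pr).
- exact: bounded_measurable_cst.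
- move=> h1; rewrite E -[leRHS](Rintegral_probability_cst P).
  apply: le_Rintegral_bounded.
  + have := bounded_measurable_comp (bU2 h1) (@measurable_swap _ _ H Omega).
    by move=> /(bounded_measurable_Rintegral Pr).
  + exact: bounded_measurable_cst.
  + by move=> h2; exact: expectation_U.
Qed.

Let U_anti e e' x : 0 < e -> e <= e' -> U e' x <= U e x.
Proof.
move=> e0 ee'; apply: ler_sum => s _; apply: ler_wpM2l; first exact: prodr_ge0.
have pe j : 0 < p j x.2 + e by rewrite ltr_wpDl // p_ge0.
have pe' j : 0 < p j x.2 + e' by rewrite ltr_wpDl ?p_ge0 // (lt_le_trans e0).
apply: ler_prod => j _; apply/andP; split.
  by rewrite exprn_ge0 // divr_ge0 // mulr_ge0 // ltW.
apply: lerXn2r; rewrite ?nnegrE.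
- by rewrite divr_ge0 // mulr_ge0 // ltW.
- by rewrite divr_ge0 // mulr_ge0 // ltW.
by rewrite ler_wpM2l // lef_pV2 ?posrE ?mulr_gt0 // ler_pM2l // lerD2l.
Qed.

Let expR_le_U e w h (r : 'I_n -> R) : 0 < e -> (forall j, 0 < r j) ->
  expR (\sum_i \sum_j u j (h, S i w) * ln (r j) +
    m%:R * (1 - \sum_j (p j h + e) * r j)) <= U e (w, h).
Proof.
move=> e0 r0; apply: (expR_le_sum_colorings (u := fun i j => u j (h, S i w))
  (p := fun j => p j h + e)) => // j.
by rewrite ltr_wpDl // p_ge0.
Qed.

(** The event is defined through [G], before [r] and [Q] are chosen. On it, [donsker_varadhan2]
    brings in [Q] and [sum_klterm_le] takes the supremum over [r]. *)
Lemma pac_bayes_colorings (delta : R) : 0 < delta ->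
  exists A : set Omega, measurable A /\ ((1 - delta)%:E <= Pr A)%E /\
    forall w, A w -> forall (Q : probability H R) (k : R), KL Q P = k%:E ->
    (\sum_j klterm
       (Rintegral2 Q Q (fun h => m%:R^-1 * \sum_i u j (h, S i w))%R)
       (Rintegral2 Q Q (fun h => \int[D]_z u j (h, z))%R)
     <= (m%:R^-1 * (2 * k + ln (C / delta)))%:E)%E.
Proof.
move=> d0; pose e k : R := k.+1%:R^-1.
have e0 k : 0 < e k by rewrite invr_gt0.
pose A k := [set w | G (e k) w <= C / delta].
have G_ge0 k w : 0 <= G (e k) w.
  by apply: Rintegral_ge0 => h1 _; apply: Rintegral_ge0 => h2 _; exact: U_ge0.
have mk k := markov_bounded (bG (e0 k)) (G_ge0 k) C_gt0 d0 (expectation_G (e0 k)).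
have mA k : measurable (A k) by have [] := mk k.
have PA k : ((1 - delta)%:E <= Pr (A k))%E by have [] := mk k.
have bUw k w : bounded_measurable (fun h => U (e k) (w, h)).
  exact: bounded_measurable_pair1 (bU (e0 k)).
have mcap : measurable (\bigcap_k A k) by exact: bigcapT_measurable.
exists (\bigcap_k A k); split => //; split.
  (* Since [U e] grows as [e] shrinks, the events decrease, and continuity from above carries the
     same probability bound to their intersection. *)
  have A_anti : {homo A : a b / (a <= b)%N >-> (b <= a)%O}.
    move=> a b ab; apply/subsetPset => w; rewrite /A /= => /(le_trans _); apply.
    apply: le_Rintegral_bounded.
    - exact: bounded_measurable_Rintegral (bUw a w).
    - exact: bounded_measurable_Rintegral (bUw b w).
    - move=> h1; apply: le_Rintegral_bounded.
      + exact: bounded_measurable_pair1 (bUw a w).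
      + exact: bounded_measurable_pair1 (bUw b w).
      + by move=> h2; apply: U_anti => //; rewrite lef_pV2 ?posrE // ler_nat.
  have PA0 : (Pr (A 0%N) < +oo)%E by rewrite (le_lt_trans (probability_le1 _ _)) ?ltry.
  have cvA := nonincreasing_cvg_mu PA0 mA mcap A_anti.
  by rewrite -(cvg_lim (@ereal_hausdorff R) cvA); apply: lime_ge;
    [apply/cvg_ex; exists (Pr (\bigcap_k A k)) | exact: nearW].
move=> w Aw Q k KLk.
pose q j := Rintegral2 Q Q (fun h => m%:R^-1 * \sum_i u j (h, S i w)).
pose pQ j := Rintegral2 Q Q (p j).
have bu' i j : bounded_measurable (fun h : H * H => u j (h, S i w)).
  exact: bounded_measurable_pair2 (bu j).
have bavg j : bounded_measurable (fun h : H * H => m%:R^-1 * \sum_i u j (h, S i w)).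
  apply: bounded_measurableM; first exact: bounded_measurable_cst.
  exact: bounded_measurable_sum.
have avg_sum1 h : \sum_j m%:R^-1 * \sum_i u j (h, S i w) = 1.
  rewrite -mulr_sumr exchange_big /= (eq_bigr (fun=> 1)) ?sumr_const //.
  by rewrite card_ord mulVf ?gt_eqF.
have p_sum1 h : \sum_j p j h = 1.
  rewrite -Rintegral_sum_bounded; last first.
    by move=> j; exact: bounded_measurable_pair1 (bu j).
  by under eq_Rintegral => z _ do rewrite u_sum1; exact: Rintegral_probability_cst.
apply: sum_klterm_le.
- move=> j; apply: (Rintegral2_ge0 Q Q (f := fun h => m%:R^-1 * \sum_i u j (h, S i w))) => h.
  by rewrite mulr_ge0 ?invr_ge0 ?ler0n // sumr_ge0.
- by move=> j; apply: (Rintegral2_ge0 Q Q (f := p j)) => h; exact: p_ge0.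
- by rewrite (sum_Rintegral2_eq1 Q Q bavg avg_sum1).
- by rewrite (sum_Rintegral2_eq1 Q Q bp p_sum1).
move=> r r0; rewrite -/(q _) -/(pQ _).
apply/ler_addgt0Pr => t t0; set sr := \sum_j r j.
have sr0 : 0 <= sr by apply: sumr_ge0 => j _; exact: ltW.
(* Raising every [p j] by [e N] costs [e N * sr]; this [N] makes the cost at most the slack [t]. *)
pose N := Num.bound (sr / t).
have eN : e N * sr <= t.
  rewrite /e mulrC ler_pdivrMr // mulrC -ler_pdivrMr //.
  have := archi_boundP (divr_ge0 sr0 (ltW t0)); rewrite -/N => /ltW/le_trans; apply.
  by rewrite ler_nat.
pose phi h := \sum_i \sum_j u j (h, S i w) * ln (r j) +
  m%:R * (1 - \sum_j (p j h + e N) * r j).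
(* Writes [phi] as an affine function of the empirical and true means, so that its [Q]-mean involves
   only [q] and [pQ]. *)
pose term j h := m%:R * ln (r j) * (m%:R^-1 * \sum_i u j (h, S i w)) +
  (- (m%:R * r j)) * p j h.
have phiE : phi = fun h => (\sum_j term j h) + m%:R * (1 - e N * sr).
  apply/funext => h; rewrite /phi /term exchange_big /= big_split /= mulrBr mulr1.
  have -> : \sum_j (p j h + e N) * r j = \sum_j p j h * r j + e N * sr.
    by rewrite /sr mulr_sumr -big_split /=; apply: eq_bigr => j _; rewrite mulrDl.
  have -> : \sum_j \sum_i u j (h, S i w) * ln (r j) =
      \sum_j m%:R * ln (r j) * (m%:R^-1 * \sum_i u j (h, S i w)).
    apply: eq_bigr => j _; rewrite -mulr_suml; field; exact: lt0r_neq0.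
  have -> : \sum_j - (m%:R * r j) * p j h = - (m%:R * \sum_j p j h * r j).
    by rewrite mulr_sumr -sumrN; apply: eq_bigr => j _; ring.
  by move: (\sum_j _) (\sum_j _) => x y; ring.
have bterm j : bounded_measurable (term j).
  apply: bounded_measurableD; apply: bounded_measurableM => //;
    exact: bounded_measurable_cst.
have bphi : bounded_measurable phi.
  rewrite phiE; apply: bounded_measurableD; last exact: bounded_measurable_cst.
  exact: bounded_measurable_sum.
have Ephi : Rintegral2 Q Q phi = m%:R * (\sum_j q j * ln (r j) - \sum_j pQ j * r j + 1 - e N * sr).
  rewrite phiE Rintegral2D; last 2 first.
  - exact: bounded_measurable_sum.
  - exact: bounded_measurable_cst.
  rewrite Rintegral2_cst Rintegral2_sum // (eq_bigr (fun j => m%:R * (q j * ln (r j)) - m%:R * (pQ j * r j))).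
    rewrite sumrB -[X in X - _ + _]mulr_sumr -[X in _ - X + _]mulr_sumr.
    by move: (\sum_j _) (\sum_j _) => x y; ring.
  move=> j _; rewrite Rintegral2D; last 2 first.
  - by apply: bounded_measurableM => //; exact: bounded_measurable_cst.
  - by apply: bounded_measurableM => //; exact: bounded_measurable_cst.
  have Eq : Rintegral2 Q Q (fun h => m%:R^-1 * \sum_i u j (h, S i w)) = q j by [].
  have Ep : Rintegral2 Q Q (p j) = pQ j by [].
  by rewrite (Rintegral2Z Q Q _ (bavg j)) (Rintegral2Z Q Q _ (bp j)) Eq Ep; ring.
have := donsker_varadhan2 bphi KLk; rewrite -[leLHS]/(Rintegral2 Q Q phi) Ephi => DV.
have lnC : ln (\int[P]_h1 \int[P]_h2 expR (phi (h1, h2))) <= ln (C / delta).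
  have bexp := bounded_measurable_expR bphi.
  (* The integrand is at most [U (e N)] by [expR_le_U], and [w] lies in [A N]. *)
  have le1 : \int[P]_h1 \int[P]_h2 expR (phi (h1, h2)) <= C / delta.
    apply: le_trans (Aw N Logic.I); apply: le_Rintegral_bounded.
    - exact: bounded_measurable_Rintegral bexp.
    - exact: bounded_measurable_Rintegral (bUw N w).
    - move=> h1; apply: le_Rintegral_bounded.
      + exact: bounded_measurable_pair1 bexp.
      + exact: bounded_measurable_pair1 (bUw N w).
      + by move=> h2; exact: expR_le_U.
  have [M fM] := bphi.2.
  rewrite ler_ln ?posrE ?divr_gt0 //.
  (* Positivity of the integral, required for the monotonicity of [ln]. *)
  apply: (@lt_le_trans _ _ (\int[P]_h1 \int[P]_h2 expR (- M))).
    under eq_Rintegral => h1 _ do rewrite Rintegral_probability_cst.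
    by rewrite Rintegral_probability_cst expR_gt0.
  apply: le_Rintegral_bounded.
  - under eq_fun do rewrite Rintegral_probability_cst; exact: bounded_measurable_cst.
  - exact: bounded_measurable_Rintegral bexp.
  - move=> h1; apply: le_Rintegral_bounded.
    + exact: bounded_measurable_cst.
    + exact: bounded_measurable_pair1 bexp.
    + by move=> h2; rewrite ler_expR; have := fM (h1, h2); rewrite ler_norml => /andP[].
have DV' : \sum_j q j * ln (r j) - \sum_j pQ j * r j + 1 - e N * sr <=
    m%:R^-1 * (2 * k + ln (C / delta)).
  rewrite [leRHS]mulrC ler_pdivlMr // [leLHS]mulrC; apply: le_trans DV _; exact: lerD.
by move: DV' eN; move: (_ + 1) => x; lra.
Qed.

End pac_bayes_colorings.

(** * The three statistics of a pair of voters *)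

Lemma kl2E (R : realType) (q p : 'I_3 -> R) : \sum_j q j = 1 -> \sum_j p j = 1 ->
  kl2 (q ord0) (q (lift ord0 ord0)) (p ord0) (p (lift ord0 ord0)) =
  (\sum_j klterm (q j) (p j))%E.
Proof.
rewrite !big_ord_recl !big_ord0 /kl2.
set j2 := lift ord0 (lift ord0 ord0); set j1 := lift ord0 ord0 => q_sum1 p_sum1.
have -> : 1 - q ord0 - q j1 = q j2 by lra.
have -> : 1 - p ord0 - p j1 = p j2 by lra.
by rewrite adde0 addeA.
Qed.

Lemma lossl_itv (R : realType) (a : R) (b : bool) : -1 <= a <= 1 ->
  0 <= lossl a (lab b) <= 1.
Proof. by rewrite /lossl /lab; case: b => /andP[? ?]; apply/andP; split; lra. Qed.

Lemma stat_fun_ge0 (R : realType) (t : stat) (a1 a2 : R) (y : bool) :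
  -1 <= a1 <= 1 -> -1 <= a2 <= 1 -> 0 <= stat_fun t a1 a2 (lab y).
Proof.
move=> h1 h2; have /andP[? ?] := lossl_itv y h1; have /andP[? ?] := lossl_itv y h2.
case: t => /=; last 2 first.
- by rewrite mulr_ge0.
- by rewrite mulr_ge0 // subr_ge0.
rewrite divr_ge0 // subr_ge0 (le_trans (ler_norm _)) // normrM.
by rewrite mulr_ile1 // ler_norml.
Qed.

(** In [e + s] the terms linear in [y] cancel, and [y^2 = 1] leaves [(1 + a1 a2) / 2], the
    complement of [d]. *)
Lemma stat_fun_sum1 (R : realType) (a1 a2 : R) (y : bool) :
  stat_fun stat_d a1 a2 (lab y) + stat_fun stat_e a1 a2 (lab y) +
  stat_fun stat_s a1 a2 (lab y) = 1.
Proof. by rewrite /stat_fun /lossl /lab; case: y; field. Qed.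

(** By [stat_fun_sum1], the expression is the third statistic. *)
Lemma stat_fun_compl_ge0 (R : realType) (s t : stat) (a1 a2 : R) (y : bool) :
  -1 <= a1 <= 1 -> -1 <= a2 <= 1 -> s <> t ->
  0 <= 1 - stat_fun s a1 a2 (lab y) - stat_fun t a1 a2 (lab y).
Proof.
move=> h1 h2 st; have := stat_fun_sum1 a1 a2 y.
have := stat_fun_ge0 stat_d y h1 h2; have := stat_fun_ge0 stat_e y h1 h2.
have := stat_fun_ge0 stat_s y h1 h2.
by case: s st => /=; case: t => //= *; lra.
Qed.

Lemma bounded_measurable_stat_fun (R : realType) (d : measure_display)
    (T : measurableType d) (t : stat) (f g y : T -> R) :
  bounded_measurable f -> bounded_measurable g -> bounded_measurable y ->
  bounded_measurable (fun x => stat_fun t (f x) (g x) (y x)).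
Proof.
move=> bf bg bY; have bc := bounded_measurable_cst (T := T) (_ : R).
by case: t => /=; rewrite /lossl;
  repeat first [exact: bc | assumption | apply: bounded_measurableN |
    apply: bounded_measurableM | apply: bounded_measurableD].
Qed.

Theorem mainTheorem12 (R : realType)
  (dX dH dO : measure_display)
  (X : measurableType dX) (H : measurableType dH) (Omega : measurableType dO)
  (v : H -> X -> R)
  (v_meas : measurable_fun [set: (H * X)%type] (fun p => v p.1 p.2))
  (v_bnd : forall h x, -1 <= v h x <= 1)
  (D : probability (X * bool)%type R) (P : probability H R)
  (delta : R) (delta_pos : 0 < delta) (delta_le1 : delta <= 1)
  (m : nat) (m_pos : (0 < m)%N)
  (Pr : probability Omega R) (S : 'I_m -> Omega -> (X * bool)%type)
  (S_iid : iid_sample Pr D S)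
  (a b : stat) (ab : a <> b) :
  exists A : set Omega, measurable A /\ ((1 - delta)%:E <= Pr A)%E /\
    forall w, A w -> forall Q : probability H R,
      (kl2 (stat_S v (fun i => S i w) Q a) (stat_S v (fun i => S i w) Q b)
           (stat_D v D Q a) (stat_D v D Q b)
       <= ((m%:R)^-1)%:E * (2%:E * KL Q P
              + (ln ((xi m + m%:R) / delta))%:E))%E.
Proof.
pose f t (x : (H * H) * (X * bool)) : R :=
  stat_fun t (v x.1.1 x.2.1) (v x.1.2 x.2.1) (lab x.2.2).
have bf t : bounded_measurable (f t).
  have bv : bounded_measurable (fun p : H * X => v p.1 p.2).
    by split => //; exists 1 => p; rewrite ler_norml.
  have mx : measurable_fun setT (fun x : (H * H) * (X * bool) => x.2.1).
    exact: (measurableT_comp measurable_fst measurable_snd).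
  apply: bounded_measurable_stat_fun.
  - apply: (bounded_measurable_comp (g := fun x => (x.1.1, x.2.1)) bv).
    apply: measurable_fun_pair => //.
    exact: (measurableT_comp measurable_fst measurable_fst).
  - apply: (bounded_measurable_comp (g := fun x => (x.1.2, x.2.1)) bv).
    apply: measurable_fun_pair => //.
    exact: (measurableT_comp measurable_snd measurable_fst).
  - split; last by exists 1 => x; rewrite /lab; case: ifP; rewrite ?normrN normr1.
    apply: measurable_fun_ifT => //.
    exact: (measurableT_comp measurable_snd measurable_snd).
(* Colours 0 and 1 carry [a] and [b], colour 2 the remaining statistic, in the order that [kl2E]
   expects. *)
pose u (j : 'I_3) x :=
  if val j == 0%N then f a x else if val j == 1%N then f b x else 1 - f a x - f b x.
have bu j : bounded_measurable (u j).
  rewrite /u; case: (val j == 0%N) => //; case: (val j == 1%N) => //.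
  apply: bounded_measurableD; last exact: bounded_measurableN.
  apply: bounded_measurableD; last exact: bounded_measurableN.
  exact: bounded_measurable_cst.
have u_ge0 j x : 0 <= u j x.
  rewrite /u; case: ifP => _; first exact: stat_fun_ge0.
  by case: ifP => _; [exact: stat_fun_ge0 | exact: stat_fun_compl_ge0].
have u_sum1 x : \sum_j u j x = 1.
  by rewrite !big_ord_recl big_ord0 /u /=; ring.
have C_gt0 : 0 < xi m + m%:R :> R.
  rewrite ltr_wpDl ?ltr0n // /xi sumr_ge0 // => k _.
  have km : k%:R / m%:R <= 1 :> R.
    by rewrite ler_pdivrMr ?ltr0n // mul1r ler_nat -ltnS.
  by rewrite !mulr_ge0 ?exprn_ge0 ?divr_ge0 ?subr_ge0.
have [A [mA [PA HA]]] := pac_bayes_colorings bu u_ge0 u_sum1 P m_pos S_iid C_gt0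
  (sum_3colorings_xi R m_pos) delta_pos.
exists A; split => //; split => // w Aw Q.
(* The value [-oo] is excluded by [KL_ge0]; for [+oo] the right-hand side is [+oo] as well. *)
have := KL_ge0 P Q; case KLQ : (KL Q P) => [k| |] // _; last first.
  rewrite mulry gtr0_sg // mul1e addye // mulry gtr0_sg ?invr_gt0 ?ltr0n //.
  by rewrite mul1e leey.
pose q j := Rintegral2 Q Q (fun h => m%:R^-1 * \sum_i u j (h, S i w)).
pose p j := Rintegral2 Q Q (fun h => \int[D]_z u j (h, z)).
have statS t j : u j = f t -> stat_S v (fun i => S i w) Q t = q j.
  move=> uf.
  have bq : bounded_measurable (fun h : H * H => m%:R^-1 * \sum_i f t (h, S i w)).
    apply: bounded_measurableM; first exact: bounded_measurable_cst.
    by apply: bounded_measurable_sum => i; exact: bounded_measurable_pair2 (bf t).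
  by rewrite /q uf; exact: (Rintegral2_fine Q Q bq).
have statD t j : u j = f t -> stat_D v D Q t = p j.
  move=> uf; have bp := bounded_measurable_Rintegral D (bf t).
  rewrite /p uf; apply: etrans (Rintegral2_fine Q Q bp); congr fine.
  apply: eq_integral => h1 _; apply: eq_integral => h2 _.
  by rewrite EFin_Rintegral //; exact: bounded_measurable_pair1 (bf t).
rewrite (statS a ord0) // (statS b (lift ord0 ord0)) //.
rewrite (statD a ord0) // (statD b (lift ord0 ord0)) //.
have q_sum1 : \sum_j q j = 1.
  apply: sum_Rintegral2_eq1 => [j|h].
    apply: bounded_measurableM; first exact: bounded_measurable_cst.
    by apply: bounded_measurable_sum => i; exact: bounded_measurable_pair2 (bu j).
  rewrite -mulr_sumr exchange_big /= (eq_bigr (fun=> 1)) ?sumr_const //.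
  by rewrite card_ord mulVf // pnatr_eq0 -lt0n.
have p_sum1 : \sum_j p j = 1.
  apply: sum_Rintegral2_eq1 => [j|h].
    exact: (bounded_measurable_Rintegral D (bu j)).
  rewrite -Rintegral_sum_bounded; last first.
    by move=> j; exact: bounded_measurable_pair1 (bu j).
  by under eq_Rintegral => z _ do rewrite u_sum1; exact: Rintegral_probability_cst.
rewrite kl2E //; exact: HA w Aw Q k KLQ.
Qed.
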